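(* Let $F$ be a known non-degenerate distribution function on $\mathbb{R}$ with finite second moment, and assume $F$ belongs to the class NCP (defined in the context). Let $\omega=\omega(F)=\inf\{x\in\mathbb{R}:F(x)=1\}$ (with $\omega=+\infty$ if $F(x)<1$ for all $x$). Suppose that $\lim_{x\to\omega-}F(x)=1$ and that $F$ is differentiable on a left neighborhood $(M,\omega)$ of $\omega$, with derivative $f(x)=F'(x)$ for $x\in(M,\omega)$. For $\delta\in\mathbb{R}$, $\gamma\in\mathbb{R}$ define \[ L(x;\delta,\gamma;F)=\frac{f(x)}{(1-F(x))^{\gamma}(-\log(1-F(x)))^{\delta}},\qquad x\in(M,\omega), \] and $L_*(\delta,\gamma;F)=\liminf_{x\to\omega-}L(x;\delta,\gamma;F)$, $L^*(\delta,\gamma;F)=\limsup_{x\to\omega-}L(x;\delta,\gamma;F)$. If either (i) for some $\gamma<3/2$ and $\delta=0$, or (ii) for some $\delta>0$ and some $\gamma$ with $1/2<\gamma\le 1$, we have \[ 0<L_*(\delta,\gamma;F)\le L^*(\delta,\gamma;F)<+\infty, \] then the partial maxima BLUE $L_2^{(n)}$ of the scale parameter $\theta_2$ is consistent (i.e. $L_2^{(n)}\to\theta_2$ in probability as $n\to\infty$, for all $\theta_1\in\mathbb{R}$, $\theta_2>0$) and, moreover, $\operatorname{Var}[L_2^{(n)}]=O(1/\log n)$ as $n\to\infty$.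
   Context: Setting: $F$ is a known, parameter-free, non-degenerate distribution function on $\mathbb{R}$ with finite second moment. For unknown $\theta_1\in\mathbb{R}$ and $\theta_2>0$, let $X_1^*,\dots,X_n^*$ be i.i.d. with distribution function $F((x-\theta_1)/\theta_2)$, and let $X^*_{j:j}=\max\{X_1^*,\dots,X_j^*\}$, $j=1,\dots,n$ (the partial maxima). A linear estimator is $\sum_{i=1}^n c_iX^*_{i:i}$ with constants $c_i$ (depending on $n$ and $F$ only). The partial maxima BLUE $L_2^{(n)}$ of $\theta_2$ is the linear estimator which is unbiased for $\theta_2$ for all $(\theta_1,\theta_2)$ and has minimum variance among all such estimators. Let $X_1,X_2,\dots$ be i.i.d. with distribution function $F$, $X_{j:j}=\max\{X_1,\dots,X_j\}$, and define the partial maxima spacings $Z_i=X_{i+1:i+1}-X_{i:i}$, $i\ge1$. $F$ (with finite second moment) belongs to the class NCP if $\operatorname{Cov}[Z_i,Z_j]\le 0$ for all positive integers $i\neq j$. *)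

(* Defs.v *)
From HB Require Import structures.
From mathcomp Require Import all_boot all_order all_algebra.
From mathcomp Require Import all_classical all_reals all_analysis.
Set Implicit Arguments. Unset Strict Implicit. Unset Printing Implicit Defensive.
Import Order.TTheory GRing.Theory Num.Theory.
Import numFieldNormedType.Exports.
Local Open Scope classical_set_scope.
Local Open Scope ring_scope.

Section pm_defs.
Context {R : realType}.

Definition mutually_independent d (T : measurableType d) (P : probability T R)
    (X : nat -> {RV P >-> R}) : Prop :=
  forall (s : seq nat) (B : nat -> set R),
    uniq s -> (forall i, measurable (B i)) ->
    P (\bigcap_(i in [set i | i \in s]) (X i @^-1` B i)) =
    \big[*%E/1%E]_(i <- s) P (X i @^-1` B i).

(* X_1, X_2, ... (indexed from 0 in Rocq) are i.i.d. with distribution function G. *)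
Definition iid_cdf d (T : measurableType d) (P : probability T R)
    (X : nat -> {RV P >-> R}) (G : R -> R) : Prop :=
  mutually_independent X /\ forall i r, cdf (X i) r = (G r)%:E.

(* partial maximum X_{j:j} = max{X_1,...,X_j}  (for j >= 1) *)
Definition pmax (T : Type) (X : nat -> T -> R) (j : nat) (w : T) : R :=
  \big[Num.max/X 0%N w]_(i < j) X i w.

(* the linear estimator  sum_{i=1}^n c_i X_{i:i}  (c i is the coefficient c_{i+1}) *)
Definition pm_est (T : Type) (n : nat) (c : nat -> R) (X : nat -> T -> R) : T -> R :=
  fun w => \sum_(i < n) c i * pmax X i.+1 w.

Definition locscale (F : R -> R) (t1 t2 : R) : R -> R := fun x => F ((x - t1) / t2).

Definition pm_unbiased_scale (F : R -> R) (n : nat) (c : nat -> R) : Prop :=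
  forall t1 t2 : R, 0 < t2 ->
  forall d (T : measurableType d) (P : probability T R) (X : nat -> {RV P >-> R}),
    iid_cdf X (locscale F t1 t2) ->
    ('E_P[pm_est n c (fun i => X i : T -> R)] = t2%:E)%E.

Definition pm_BLUE_scale (F : R -> R) (n : nat) (c : nat -> R) : Prop :=
  pm_unbiased_scale F n c /\
  forall c' : nat -> R, pm_unbiased_scale F n c' ->
  forall t1 t2 : R, 0 < t2 ->
  forall d (T : measurableType d) (P : probability T R) (X : nat -> {RV P >-> R}),
    iid_cdf X (locscale F t1 t2) ->
    ('V_P[pm_est n c (fun i => X i : T -> R)] <=
     'V_P[pm_est n c' (fun i => X i : T -> R)])%E.

Definition pm_spacing (T : Type) (X : nat -> T -> R) (i : nat) : T -> R :=
  fun w => pmax X i.+1 w - pmax X i w.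

Definition NCP (F : R -> R) : Prop :=
  forall d (T : measurableType d) (P : probability T R) (X : nat -> {RV P >-> R}),
    iid_cdf X F ->
    forall i j : nat, (0 < i)%N -> (0 < j)%N -> i != j ->
    (covariance P (pm_spacing (fun k => X k : T -> R) i)
                  (pm_spacing (fun k => X k : T -> R) j) <= 0)%E.

Definition right_endpoint (F : R -> R) : \bar R :=
  ereal_inf [set x%:E | x in [set x | F x = 1]].

Definition at_left_e (w : \bar R) : set_system R :=
  match w with
  | r%:E => at_left r
  | +oo%E => pinfty_nbhs R
  | -oo%E => ninfty_nbhs R  (* never used: omega(F) > -oo *)
  end.

Definition Lfun (f F : R -> R) (delta gamma : R) (x : R) : R :=
  f x / (powR (1 - F x) gamma * powR (- ln (1 - F x)) delta).

Definition Llow (f F : R -> R) (delta gamma : R) : \bar R :=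
  limf_einf (fun x => (Lfun f F delta gamma x)%:E) (at_left_e (right_endpoint F)).
Definition Lupp (f F : R -> R) (delta gamma : R) : \bar R :=
  limf_esup (fun x => (Lfun f F delta gamma x)%:E) (at_left_e (right_endpoint F)).

End pm_defs.

(* Main.v *)
(* The BLUE has at most the variance of any unbiased competitor.  Take
   sum_i a_i Z_i with a_i proportional to 1 / (i E[Z_i]).  Under NCP its variance
   is at most sum_i a_i^2 Var[Z_i], so Var[Z_i] <= G i E[Z_i]^2 for all i >= 1
   gives a bound of order 1 / (1 + 1/2 + ... + 1/(n-1)) = O(1 / log n), and
   Chebyshev gives consistency.
   For the ratio bound, choose x_k with 1 - F(x_k) = u / 2^k.  By the mean value
   theorem and the tail condition, the gaps d_k = x_(k+1) - x_k satisfy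
   d_(k+n) <= C rho^n d_k and d_k <= C B^n d_(k+n), where rho^2 < 2 can be
   arranged because rho is essentially 2^(gamma-1) and gamma < 3/2.
   For 2^K <= i < 2^(K+1), the event that the maximum M of the first i variables
   is below x_K and the next variable exceeds x_(K+1) shows E[Z_i] >= c d_K / 2^K,
   while slicing M and the new variable along the levels gives
   E[Z_i^2] <= C d_K^2 / 2^K. *)
Require Import Defs.
From HB Require Import structures.
From mathcomp Require Import all_boot all_order all_algebra.
From mathcomp Require Import all_classical all_reals all_analysis.
From mathcomp Require Import ring lra measurable_realfun.
Import Order.TTheory GRing.Theory Num.Theory.
Import numFieldNormedType.Exports.
Local Open Scope classical_set_scope.
Local Open Scope ring_scope.

Set Implicit Arguments.
Unset Strict Implicit.
Unset Printing Implicit Defensive.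

(** * Dyadic levels of the upper tail *)

(** The two directions along the levels are not symmetric. Going up, the gaps may grow per level
    only by a factor whose square is below 2, because the tail is merely halved; there the
    logarithmic factor of the tail condition costs a constant, so the rate depends on gamma alone.
    Going down, any geometric rate will do: for i >= 2^K the maximum stays below x_(k+1) with
    probability at most exp(-(u/2) 2^(K-k)), which beats every power B^(K-k). This treats both
    alternatives of the hypothesis at once, with delta = 0 in the first. Below x_0 only the second
    moment of F is available; that part of E[Z_i^2] is damped by F(x_0)^(i-1). Unbiasedness
    quantifies over all probability spaces while the weights are computed on one, so the
    expectations of the maxima have to be shown to depend on the cdf only. *)

Section tail_weight.
Context {R : realType}.
Implicit Types (g e s t : R) (n : nat).

(** The denominator of [Lfun] as a function of the tail value t = 1 - F(x); the tail condition puts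
    f(x) between two positive multiples of it. *)
Definition tail_weight g e t : R := powR t g * powR (- ln t) e.

Lemma ln_half_ge t : 0 < t -> t <= 1 / 2 -> ln 2 <= - ln t.
Proof.
move=> t0 th; rewrite -lnV ?posrE// ler_ln ?posrE ?invr_gt0//.
by rewrite -[2]invrK lef_pV2 ?posrE ?invr_gt0//; lra.
Qed.

Lemma ln2_gt0 : 0 < ln 2 :> R.
Proof. by apply: ln_gt0; lra. Qed.

Lemma tail_weight_gt0 g e t : 0 < t -> t <= 1 / 2 -> 0 < tail_weight g e t.
Proof.
move=> t0 th; rewrite mulr_gt0 ?powR_gt0//.
by rewrite (lt_le_trans ln2_gt0)// ln_half_ge.
Qed.

Lemma ln_shift s t n : 0 < s -> 0 < t -> t <= s * 2 ^+ n -> ln t <= ln s + n%:R * ln 2.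
Proof.
move=> s0 t0 ts; have h : 0 < s * 2 ^+ n by rewrite mulr_gt0// exprn_gt0.
apply: (@le_trans _ _ (ln (s * 2 ^+ n))); first by rewrite ler_ln ?posrE.
by rewrite lnM ?posrE ?exprn_gt0// lnXn ?ltr0n// mulr_natl.
Qed.

(** The hypotheses say that t / s equals 2^n up to a factor 2 either way. This is what is known
    about the tail values at the mean value points of two gaps that are n levels apart. *)
Lemma ln_ratio_le s t n : 0 < s -> 0 < t ->
  t <= s * 2 ^+ n.+1 -> s * 2 ^+ n <= t * 2 -> `|ln t - ln s - n%:R * ln 2| <= ln 2.
Proof.
move=> s0 t0 ts st.
have h1 := ln_shift s0 t0 ts.
have h2 : ln s + n%:R * ln 2 <= ln t + ln 2.
  rewrite -[X in _ <= _ + X]mul1r mulr_natl -lnXn ?ltr0n//.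
  rewrite mul1r -!lnM ?posrE ?exprn_gt0//.
  by rewrite ler_ln ?posrE// mulr_gt0// exprn_gt0.
by rewrite ler_norml; rewrite -natr1 in h1; apply/andP; split; lra.
Qed.

Lemma powR_ratio_le g s t n : 0 < s -> 0 < t ->
  t <= s * 2 ^+ n.+1 -> s * 2 ^+ n <= t * 2 ->
  powR t g <= powR 2 `|g| * powR 2 (g * n%:R) * powR s g.
Proof.
move=> s0 t0 ts st; have h3 := ln_ratio_le s0 t0 ts st.
rewrite /powR !gt_eqF// -!expRD ler_expR.
have : g * (ln t - ln s - n%:R * ln 2) <= `|g| * ln 2.
  by rewrite (le_trans (ler_norm _))// normrM ler_wpM2l.
by lra.
Qed.

Lemma powR_ratio_ge g s t n : 0 < s -> 0 < t ->
  t <= s * 2 ^+ n.+1 -> s * 2 ^+ n <= t * 2 ->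
  powR s g <= powR 2 `|g| * powR 2 (- g * n%:R) * powR t g.
Proof.
move=> s0 t0 ts st; have h3 := ln_ratio_le s0 t0 ts st.
rewrite /powR !gt_eqF// -!expRD ler_expR.
have : - g * (ln t - ln s - n%:R * ln 2) <= `|g| * ln 2.
  by rewrite (le_trans (ler_norm _))// normrM normrN ler_wpM2l.
by lra.
Qed.

Lemma powR_ln_le e a s t : 0 <= e -> 0 < a -> 0 < t -> t <= 1 / 2 -> 0 < s ->
    s <= 1 / 2 -> - ln t <= a * - ln s ->
  powR (- ln t) e <= powR a e * powR (- ln s) e.
Proof.
move=> e0 a0 t0 th s0 sh h; have ls := lt_le_trans ln2_gt0 (ln_half_ge s0 sh).
have lt := lt_le_trans ln2_gt0 (ln_half_ge t0 th).
by rewrite -powRM ?(ltW a0) ?(ltW ls)// ge0_ler_powR// nnegrE ltW// mulr_gt0.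
Qed.

(** Since s <= 2 t and s <= 1/2, -ln t is at most 2 (-ln s). For e >= 0 the logarithm thus
    contributes a constant independent of n, and the rate in n comes from g alone. *)
Lemma tail_weight_up g e s t n : 0 <= e -> 0 < s -> s <= 1 / 2 -> 0 < t ->
    t <= 1 / 2 -> t <= s * 2 ^+ n.+1 -> s * 2 ^+ n <= t * 2 ->
  tail_weight g e t <= powR 2 (`|g| + e) * powR 2 (g * n%:R) * tail_weight g e s.
Proof.
move=> e0 s0 sh t0 th ts st.
have A := powR_ratio_le g s0 t0 ts st.
have B : powR (- ln t) e <= powR 2 e * powR (- ln s) e.
  apply: powR_ln_le => //.
  have : ln s <= ln (t * 2).
    rewrite ler_ln ?posrE ?mulr_gt0//; apply: le_trans st.
    by apply: ler_peMr; [exact: ltW|apply: exprn_ege1; rewrite ler1n].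
  by rewrite lnM ?posrE//; have := ln_half_ge s0 sh; lra.
apply: le_trans (ler_pM _ _ A B) _; rewrite ?powR_ge0// powRD ?pnatr_eq0 ?implybT//.
by rewrite /tail_weight le_eqVlt; apply/orP; left; apply/eqP; ring.
Qed.

(** Here the logarithm does grow with n: -ln s <= (n + 2) (-ln t). The crude bound n + 2 <= 2^(n+1)
    turns this into a geometric factor, which is enough in this direction. *)
Lemma tail_weight_down g e s t n : 0 <= e -> 0 < s -> s <= 1 / 2 -> 0 < t ->
    t <= 1 / 2 -> t <= s * 2 ^+ n.+1 -> s * 2 ^+ n <= t * 2 ->
  tail_weight g e s <= powR 2 (`|g| + e) * powR 2 ((e - g) * n%:R) * tail_weight g e t.
Proof.
move=> e0 s0 sh t0 th ts st.
have A := powR_ratio_ge g s0 t0 ts st.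
have B : powR (- ln s) e <= powR (2 ^+ n.+1) e * powR (- ln t) e.
  apply: powR_ln_le; rewrite ?exprn_gt0//.
  have := ln_half_ge t0 th; have := ln_ratio_le s0 t0 ts st.
  rewrite ler_norml => /andP[_ h1] h2.
  have h3 : n.+2%:R <= (2 ^+ n.+1 : R).
    by rewrite -natrX ler_nat ltn_expl.
  have h4 : n.+2%:R * ln 2 <= (2 ^+ n.+1 : R) * - ln t.
    by apply: ler_pM => //; exact/ltW/ln2_gt0.
  have h5 : n.+2%:R * (- ln t) <= (2 ^+ n.+1 : R) * - ln t.
    by rewrite ler_wpM2r// (le_trans (ltW ln2_gt0)).
  have h6 : n.+1%:R * ln 2 <= n.+1%:R * (- ln t) by rewrite ler_wpM2l.
  apply: le_trans h5; rewrite -natr1 mulrDl mul1r.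
  apply: le_trans (lerD h6 (lexx _)); rewrite -natr1 mulrDl mul1r; lra.
apply: le_trans (ler_pM _ _ A B) _; rewrite ?powR_ge0//.
rewrite -powR_mulrn// -powRrM mulrDl -(natr1 n) mulrDl mul1r mulNr (mulrC _ e).
rewrite /tail_weight le_eqVlt; apply/orP; left; apply/eqP.
by rewrite !powRD ?pnatr_eq0 ?implybT//; ring.
Qed.

End tail_weight.

Section dyadic_levels.
Context {R : realType}.
Implicit Types (F f : R -> R) (x d : nat -> R) (w : \bar R).

(* rho ^+ 2 < 2 is what makes the series for the second moment above a level
   converge; B only controls the geometric growth towards lower levels. *)
Definition dyadic_levels F x (u C rho B : R) :=
  [/\ 0 < u <= 1 / 2, forall k, F (x k) = 1 - u / 2 ^+ k,
      forall k, x k < x k.+1,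
      forall K n, x (K + n).+1 - x K <= C * rho ^+ n * (x K.+1 - x K) &
      forall k n, x (k + n)%N - x k <= C * B ^+ n * (x (k + n).+1 - x (k + n)%N)].

(** The constant D = C rho / (rho - 1) solves D rho = C rho + D, so the induction step closes with
    equality. *)
Lemma sum_gaps_up x (C rho : R) : 1 < rho -> 0 <= C -> (forall k, x k < x k.+1) ->
  (forall k n, x (k + n).+1 - x (k + n)%N <= C * rho ^+ n * (x k.+1 - x k)) ->
  forall K n, x (K + n).+1 - x K <= C * rho / (rho - 1) * rho ^+ n * (x K.+1 - x K).
Proof.
move=> r1 C0 xinc h K; have d0 : 0 < x K.+1 - x K by rewrite subr_gt0.
have c : C * rho / (rho - 1) * (rho - 1) = C * rho by rewrite divfK// subr_eq0 gt_eqF.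
elim=> [|n IH].
  have := h K 0%N; rewrite addn0 expr0 !mulr1 => /le_trans; apply.
  rewrite ler_wpM2r ?(ltW d0)// -mulrA ler_peMr// ler_pdivlMr; lra.
have := h K n.+1; rewrite addnS => h1.
have -> : x (K + n).+2 - x K = (x (K + n).+2 - x (K + n).+1) + (x (K + n).+1 - x K) by lra.
apply: le_trans (lerD h1 IH) _.
rewrite -mulrDl ler_wpM2r ?(ltW d0)//.
rewrite -subr_ge0 exprSr.
set D := C * rho / (rho - 1) in c *.
have -> : D * (rho ^+ n * rho) - (C * (rho ^+ n * rho) + D * rho ^+ n) =
  rho ^+ n * (D * (rho - 1) - C * rho) by ring.
by rewrite c subrr mulr0.
Qed.

(** Peeling off the lowest gap needs 2 C B^n + C B^(n+1) <= 2 C B^(n+1), which is B >= 2. *)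
Lemma sum_gaps_down x (C B : R) : 2 <= B -> 0 <= C -> (forall k, x k < x k.+1) ->
  (forall k n, x k.+1 - x k <= C * B ^+ n * (x (k + n).+1 - x (k + n)%N)) ->
  forall k n, x (k + n)%N - x k <= 2 * C * B ^+ n * (x (k + n).+1 - x (k + n)%N).
Proof.
move=> B2 C0 xinc h k n; elim: n k => [|n IH] k.
  by rewrite addn0 subrr !mulr_ge0// subr_ge0 ltW.
have -> : x (k + n.+1)%N - x k = (x (k.+1 + n)%N - x k.+1) + (x k.+1 - x k).
  by rewrite addnS addSn; lra.
apply: le_trans (lerD (IH k.+1) (h k n.+1)) _.
rewrite addnS addSn; set y := _ - x (k + n).+1.
rewrite -mulrDl ler_wpM2r ?subr_ge0 ?(ltW (xinc _))// exprSr.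
have : 0 <= C * (B ^+ n) * (B - 2) by rewrite !mulr_ge0 ?exprn_ge0//; lra.
by lra.
Qed.

(** Trades the filter for an explicit interval up to the endpoint, so that finite and infinite
    endpoints are treated alike afterwards. *)
Lemma at_left_e_interval w (a : R) (P : set R) : (a%:E < w)%E ->
  (\forall x \near at_left_e w, P x) ->
  exists2 y, (a < y /\ (y%:E < w)%E) & forall z, y <= z -> (z%:E < w)%E -> P z.
Proof.
case: w => [r| |] //= ar.
  rewrite lte_fin in ar; rewrite /at_left /within /= => /nbhs_ballP[e /= e0 he].
  have [y [ay ey yr]] : exists y, [/\ a < y, r - e < y & y < r].
    have m : Num.max a (r - e) < r by rewrite gt_max ar; lra.
    exists ((Num.max a (r - e) + r) / 2).
    have : a <= Num.max a (r - e) by rewrite le_max lexx.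
    have : r - e <= Num.max a (r - e) by rewrite le_max lexx orbT.
    by move=> *; split; lra.
  exists y => // z yz; rewrite lte_fin => zr; apply: he => //.
  by rewrite /ball/= ger0_norm; lra.
move=> [N [_ hN]]; exists (Num.max a N + 1); first split.
- by rewrite (@le_lt_trans _ _ (Num.max a N)) ?le_max ?lexx//; lra.
- by rewrite ltry.
- move=> z hz _; apply: hN; apply: lt_le_trans hz.
  by rewrite (@le_lt_trans _ _ (Num.max a N)) ?le_max ?lexx ?orbT//; lra.
Qed.

Lemma exists_dyadic_levels F f w (a g e m b : R) :
  {homo F : s t / s <= t} -> (a%:E < w)%E -> F @ at_left_e w --> (1 : R) ->
  (forall s, a <= s -> (s%:E < w)%E -> is_derive s 1 F (f s)) ->
  (forall s, a <= s -> (s%:E < w)%E -> 1 / 2 <= F s < 1) ->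
  0 <= e -> g < 3 / 2 -> 0 < m -> 0 < b ->
  (forall s, a <= s -> (s%:E < w)%E ->
     m * tail_weight g e (1 - F s) <= f s <= b * tail_weight g e (1 - F s)) ->
  exists x u C rho B, [/\ dyadic_levels F x u C rho B, 0 < C, 1 < rho, rho ^+ 2 < 2 & 2 <= B].
Proof.
move=> Fnd aw F1 dF Fb e0 g32 m0 b0 fb.
have Fa := Fb a (lexx a) aw; pose u := 1 - F a.
have u0 : 0 < u by rewrite subr_gt0; case/andP: Fa.
have uh : u <= 1 / 2 by rewrite /u; case/andP: Fa; lra.
have contF s t : a <= s -> (t%:E < w)%E -> {within `[s, t], continuous F}.
  move=> as_ tw; apply: derivable_within_continuous => z.
  rewrite in_itv/= => /andP[sz zt]; apply: ex_derive; apply: dF; first exact: le_trans sz.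
  by apply: le_lt_trans tw; rewrite lee_fin.
(* By the intermediate value theorem the tail values are hit exactly: F is continuous from a on and
   tends to 1 at the endpoint. *)
have exx k : exists s, [/\ a <= s, (s%:E < w)%E & F s = 1 - u / 2 ^+ k].
  have v0 : 0 < u / 2 ^+ k by rewrite divr_gt0// exprn_gt0.
  have : \forall t \near at_left_e w, 1 - u / 2 ^+ k <= F t.
    have FF : Filter (at_left_e w) by case: (w) => [?| |] /=; typeclasses eauto.
    by apply: (cvgr_ge 1 F1); lra.
  move=> /(at_left_e_interval aw)[y [ay yw] /(_ y (lexx _) yw) hy].
  have [|c] := @IVT _ F a y (1 - u / 2 ^+ k) (ltW ay) (contF _ _ (lexx _) yw).
    rewrite min_l ?max_r ?Fnd ?(ltW ay)// hy andbT.
    have : u / 2 ^+ k <= u.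
      by rewrite ler_pdivrMr ?exprn_gt0// ler_peMr ?(ltW u0)// exprn_ege1// ler1n.
    by rewrite {2}/u; lra.
  rewrite in_itv/= => /andP[ac cy] Fc; exists c; split => //.
  by apply: le_lt_trans yw; rewrite lee_fin.
have /choice[x hx] := exx.
have ax k : a <= x k by case: (hx k).
have xw k : ((x k)%:E < w)%E by case: (hx k).
have Fx k : F (x k) = 1 - u / 2 ^+ k by case: (hx k).
have xinc k : x k < x k.+1.
  rewrite ltNge; apply/negP => /Fnd; rewrite !Fx leNgt ltrD2l ltrN2 => /negP; apply.
  by rewrite ltr_pM2l// ltf_pV2 ?posrE ?exprn_gt0// exprSr ltr_pMr ?exprn_gt0// ltr1n.
(* The increment of F over the k-th gap is u / 2^(k+1), and it equals f(z) d_k at a mean value point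
   z. With t = 1 - F(z) this pins d_k, up to constants, to (u / 2^(k+1)) / [tail_weight g e t]. *)
have gap k : exists t, [/\ 0 < t <= 1/2, t <= u / 2 ^+ k, u / 2 ^+ k <= t * 2,
    m * tail_weight g e t * (x k.+1 - x k) <= u / 2 ^+ k.+1 &
    u / 2 ^+ k.+1 <= b * tail_weight g e t * (x k.+1 - x k)].
  have [z zx|z] := @MVT _ F f _ _ (xinc k) _ (contF _ _ (ax k) (xw k.+1)).
    move: zx; rewrite in_itv/= => /andP[xz zx]; apply: dF; first exact: le_trans (ltW xz).
    by apply: lt_trans (xw k.+1); rewrite lte_fin.
  rewrite in_itv/= => /andP[xz zx] Fz.
  have az : a <= z := le_trans (ax k) (ltW xz).
  have zw : (z%:E < w)%E by apply: lt_trans (xw k.+1); rewrite lte_fin.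
  exists (1 - F z); have := Fb z az zw; have := fb z az zw.
  move=> /andP[f1 f2] /andP[F1' F2'].
  have := Fnd _ _ (ltW xz); have := Fnd _ _ (ltW zx); rewrite !Fx => h1 h2.
  have E : u / 2 ^+ k = u / 2 ^+ k.+1 * 2.
    by rewrite exprSr invfM mulrA divfK// pnatr_eq0.
  have E2 : u / 2 ^+ k.+1 = f z * (x k.+1 - x k) by rewrite -Fz !Fx; lra.
  split; try lra.
  - by rewrite E2 ler_wpM2r// subr_ge0 ltW.
  - by rewrite E2 ler_wpM2r// subr_ge0 ltW.
have /choice[t ht] := gap.
pose A := powR 2 (`|g| + e); have A0 : 0 < A by rewrite powR_gt0.
pose C := b / m * A; have C0 : 0 < C by rewrite mulr_gt0// divr_gt0.
(* The gaps grow at rate 2^(g-1). Replacing g by at least 5/4 forces rho > 1, and staying below 3/2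
   keeps rho^2 < 2. *)
pose rho : R := powR 2 (Num.max g (5 / 4) - 1).
have g' : 5 / 4 <= Num.max g (5 / 4) < 3 / 2.
  by rewrite le_max lexx orbT gt_max g32/=; lra.
have rho1 : 1 < rho.
  rewrite -[ltLHS](powRr0 2) /rho /powR !gt_eqF// ltr_expR mul0r mulr_gt0 ?ln2_gt0//; lra.
have rho2 : rho ^+ 2 < 2.
  rewrite -powR_mulrn ?powR_ge0// -powRrM -[ltRHS](powRr1) //.
  rewrite /powR !gt_eqF// ltr_expR ltr_pM2r ?ln2_gt0//; lra.
(* Downwards the rate is 2^(1+e-g); using |g| instead of -g also ensures B >= 2. *)
pose B : R := powR 2 (1 + `|g| + e).
have B2 : 2 <= B.
  rewrite -[leLHS](@powRr1 _ 2)// ler_powR ?ler1n//.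
  by have := normr_ge0 g; lra.
have W0 k : 0 < tail_weight g e (t k) by case: (ht k) => /andP[? ?] *; apply: tail_weight_gt0.
have D0 k : 0 < x k.+1 - x k by rewrite subr_gt0.
have shift k n : u / 2 ^+ k = u / 2 ^+ (k + n) * 2 ^+ n.
  by rewrite exprD invfM mulrA divfK// expf_eq0 pnatr_eq0 andbF.
have shiftS k n : u / 2 ^+ k.+1 = u / 2 ^+ (k + n).+1 * 2 ^+ n by rewrite -addSn -shift.
have T1 k n : t k <= t (k + n)%N * 2 ^+ n.+1.
  case: (ht k) (ht (k + n)%N) => _ h _ _ _ [_ _ h' _ _].
  by rewrite exprS mulrA (le_trans h)// (shift k n) ler_wpM2r// exprn_ge0.
have T2 k n : t (k + n)%N * 2 ^+ n <= t k * 2.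
  case: (ht k) (ht (k + n)%N) => _ _ h _ _ [_ h' _ _ _].
  by apply: le_trans h; rewrite (shift k n) ler_wpM2r// exprn_ge0.
(* The mean value estimates at levels k and k + n are compared through the ratio of weights. The
   weights cancel, and the ratio 2^n of the two increments lowers the rate from 2^(g n) to 2^((g-1)
   n). *)
have up k n : x (k + n).+1 - x (k + n)%N <= C * rho ^+ n * (x k.+1 - x k).
  case: (ht k) (ht (k + n)%N) => /andP[t0 th] _ _ _ h2 [/andP[s0 sh] _ _ h3 _].
  have := tail_weight_up g e0 s0 sh t0 th (T1 k n) (T2 k n).
  rewrite -/A; move: h2 h3; rewrite (shiftS k n).
  have := W0 (k + n)%N; have := W0 k; have := D0 (k + n)%N; have := D0 k.
  move: (x k.+1 - x k) (x (k + n).+1 - x (k + n)%N) (tail_weight g e (t k))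
    (tail_weight g e (t (k + n)%N)) => D D' V W.
  move=> pD pD' pV pW h2 h3 h4.
  have r2 : powR 2 (g * n%:R) <= rho ^+ n * 2 ^+ n.
    rewrite -!powR_mulrn ?powR_ge0// -powRrM -powRD ?pnatr_eq0 ?implybT//.
    rewrite ler_powR ?ler1n// mulrBl mul1r subrK ler_wpM2r//.
    by rewrite le_max lexx.
  rewrite -(ler_pM2l m0) -(ler_pM2l pW) -(@ler_pM2r _ (2 ^+ n)) ?exprn_gt0//.
  rewrite mulrCA mulrA; apply: le_trans (ler_wpM2r _ h3) _; first exact: exprn_ge0.
  apply: (le_trans h2); apply: le_trans (_ : b * (A * (rho ^+ n * 2 ^+ n) * W) * D <= _).
    rewrite ler_wpM2r ?(ltW pD)// ler_wpM2l ?(ltW b0)// (le_trans h4)//.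
    by rewrite ler_wpM2r ?(ltW pW)// ler_wpM2l// ltW.
  by rewrite /C le_eqVlt; apply/orP; left; apply/eqP; field; rewrite gt_eqF.
have down k n : x k.+1 - x k <= C * B ^+ n * (x (k + n).+1 - x (k + n)%N).
  case: (ht k) (ht (k + n)%N) => /andP[t0 th] _ _ h2 _ [/andP[s0 sh] _ _ _ h3].
  have := tail_weight_down g e0 s0 sh t0 th (T1 k n) (T2 k n).
  rewrite -/A; move: h2 h3; rewrite (shiftS k n).
  have := W0 (k + n)%N; have := W0 k; have := D0 (k + n)%N; have := D0 k.
  move: (x k.+1 - x k) (x (k + n).+1 - x (k + n)%N) (tail_weight g e (t k))
    (tail_weight g e (t (k + n)%N)) => D D' V W.
  move=> pD pD' pV pW h2 h3 h4.
  have r2 : powR 2 ((e - g) * n%:R) * 2 ^+ n <= B ^+ n.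
    rewrite -!powR_mulrn ?powR_ge0// -powRrM -powRD ?pnatr_eq0 ?implybT//.
    rewrite ler_powR ?ler1n// -[X in _ + X]mul1r -mulrDl ler_wpM2r//.
    by have := ler_norm (- g); rewrite normrN; lra.
  rewrite -(ler_pM2l m0) -(ler_pM2l pV).
  rewrite mulrCA mulrA; apply: (le_trans h2).
  apply: le_trans (ler_wpM2r _ h3) _; first exact: exprn_ge0.
  apply: le_trans (_ : b * (A * powR 2 ((e - g) * n%:R) * V) * D' * 2 ^+ n <= _).
    by rewrite ler_wpM2r ?exprn_ge0// ler_wpM2r ?(ltW pD')// ler_wpM2l// ltW.
  have h0 : 0 <= b * A * V * D' by rewrite !mulr_ge0// ltW.
  have := ler_wpM2l h0 r2; set q := powR _ _; move=> h5.
  apply: le_trans (_ : b * A * V * D' * (q * 2 ^+ n) <= _).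
    by rewrite le_eqVlt; apply/orP; left; apply/eqP; ring.
  apply: (le_trans h5).
  by rewrite /C le_eqVlt; apply/orP; left; apply/eqP; field; rewrite gt_eqF.
have S1 := sum_gaps_up rho1 (ltW C0) xinc up.
have S2 := sum_gaps_down B2 (ltW C0) xinc down.
have C1 : 0 <= C * rho / (rho - 1).
  apply: divr_ge0; last by rewrite subr_ge0 ltW.
  by apply: mulr_ge0; [exact: ltW | exact: le_trans ler01 (ltW rho1)].
(* Adding the two constants lets a single one serve both directions. *)
exists x, u, (C * rho / (rho - 1) + 2 * C), rho, B; split => //; last first.
  by rewrite ltr_wpDl// mulr_gt0// ltr0n.
split=> //; first by rewrite u0.
- move=> K n; apply: (le_trans (S1 K n)).
  rewrite ler_wpM2r ?(ltW (D0 _))// ler_wpM2r ?exprn_ge0 ?(le_trans ler01 (ltW rho1))//.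
  by rewrite lerDl mulr_ge0// ltW.
- move=> k n; apply: (le_trans (S2 k n)).
  by rewrite ler_wpM2r ?(ltW (D0 _))// ler_wpM2r ?exprn_ge0 ?(le_trans (ler0n _ 2) B2)// lerDr.
Qed.

End dyadic_levels.

(** * From the limits inferior and superior to two-sided bounds on the density *)

Section tail_condition.
Context {R : realType} (F f : R -> R).
Local Notation w := (right_endpoint F).

Lemma limf_einf_gt0 (S : set_system R) (h : R -> R) : Filter S ->
  (0 < limf_einf (fun x => (h x)%:E) S)%E ->
  exists2 m, 0 < m & \forall x \near S, m <= h x.
Proof.
move=> FS; rewrite limf_einfE => /ereal_sup_gt[_ [V SV <-]] V0.
have [m m0 mV] : exists2 m : R, 0 < m & (m%:E <= ereal_inf ((fun x => (h x)%:E) @` V))%E.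
  move: V0; case: (ereal_inf _) => [r| |] //; first by exists r.
  by exists 1 => //; rewrite leey.
exists m => //; apply: filterS SV => x Vx.
by rewrite -lee_fin (le_trans mV)//; apply: ereal_inf_lbound; exists x.
Qed.

Lemma limf_esup_lty (S : set_system R) (h : R -> R) : Filter S ->
  (limf_esup (fun x => (h x)%:E) S < +oo)%E ->
  exists2 b, 0 < b & \forall x \near S, h x <= b.
Proof.
move=> FS; rewrite limf_esupE => /ereal_inf_lt[_ [V SV <-]] V0.
have [b b0 bV] : exists2 b : R, 0 < b & (ereal_sup ((fun x => (h x)%:E) @` V) <= b%:E)%E.
  move: V0; case: (ereal_sup _) => [r| |] // _; last by exists 1 => //; rewrite leNye.
  by exists (`|r| + 1); [rewrite ltr_pwDr|rewrite lee_fin (le_trans (ler_norm r))// lerDl].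
exists b => //; apply: filterS SV => x Vx.
by rewrite -lee_fin (le_trans _ bV)//; apply: ereal_sup_ubound; exists x.
Qed.

Lemma dyadic_levels_of_tail (M g e : R) :
  {homo F : s t / s <= t} -> (forall s, F s <= 1) ->
  F @ at_left_e w --> (1 : R) -> (M%:E < w)%E ->
  (forall x, M < x -> (x%:E < w)%E -> is_derive x 1 F (f x)) ->
  0 <= e -> g < 3 / 2 -> (0 < Llow f F e g)%E -> (Lupp f F e g < +oo)%E ->
  exists x u C rho B, [/\ dyadic_levels F x u C rho B, 0 < C, 1 < rho, rho ^+ 2 < 2 & 2 <= B].
Proof.
move=> Fnd F1 Fw Mw dF e0 g32.
have FF : Filter (at_left_e w) by case: (w) => [?| |] /=; typeclasses eauto.
move=> /(limf_einf_gt0 FF)[m m0 hm] /(limf_esup_lty FF)[b b0 hb].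
have hF : \forall x \near at_left_e w, 1 / 2 <= F x by apply: (cvgr_ge 1 Fw); lra.
have h := @filterI _ _ FF _ _ hF (@filterI _ _ FF _ _ hm hb).
have [a [Ma aw] ha] := at_left_e_interval Mw h.
(* A point with F(s) = 1 would lie in the set whose infimum is the endpoint. The tail is therefore
   positive below the endpoint, and the denominator of [Lfun] can be cleared. *)
have Flt s : (s%:E < w)%E -> F s < 1.
  move=> sw; rewrite lt_neqAle F1 andbT; apply/eqP => Fs.
  move: sw; rewrite ltNge => /negP; apply; apply: ereal_inf_lbound.
  by exists s.
apply: (@exists_dyadic_levels _ F f w a g e m b) => //.
- by move=> s as_ sw; apply: dF => //; exact: lt_le_trans as_.
- by move=> s as_ sw; have [-> _] := ha s as_ sw; rewrite Flt.
move=> s as_ sw; have [Fs [ms bs]] := ha s as_ sw.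
have W0 : 0 < tail_weight g e (1 - F s).
  by apply: tail_weight_gt0; [rewrite subr_gt0 Flt|lra].
by move: ms bs; rewrite /Defs.Lfun -/(tail_weight g e _) ler_pdivlMr// ler_pdivrMr// => -> ->.
Qed.

End tail_condition.

(** * Laws, partial maxima and spacings *)

Lemma Lfun2P {R : realType} d (T : measurableType d) (mu : {measure set T -> \bar R})
    (h : T -> R) : measurable_fun setT h -> (\int[mu]_w (h w ^+ 2)%:E < +oo)%E ->
  h \in Lfun mu 2%:E.
Proof.
move=> mh hfin; rewrite inE; apply/andP; split; rewrite inE//=.
rewrite /finite_norm unlock poweR_lty//.
apply: le_lt_trans hfin; rewrite ge0_le_integral//.
- by move=> w _; exact: poweR_ge0.
- apply/measurable_EFinP.
  apply/(@measurableT_comp _ _ _ _ _ _ (fun x : R => powR x 2)%R) => //.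
  exact/measurableT_comp.
- by apply/measurable_EFinP; exact: measurable_funX.
- by move=> w _/=; rewrite lee_fin powR_mulrn// -normrX ger0_norm// sqr_ge0.
Qed.

Section law.
Context {R : realType} d1 (T1 : measurableType d1) (P1 : probability T1 R)
  d2 (T2 : measurableType d2) (P2 : probability T2 R)
  (X1 : {RV P1 >-> R}) (X2 : {RV P2 >-> R}).
Hypothesis eq_cdf : forall r, cdf X1 r = cdf X2 r.

(** The open upper half-lines are stable under intersection and generate the Borel sets, and their
    probabilities are complements of the cdf. *)
Lemma eq_law (B : set R) : measurable B -> P1 (X1 @^-1` B) = P2 (X2 @^-1` B).
Proof.
move=> mB; rewrite -[LHS]/(distribution P1 X1 B) -[RHS]/(distribution P2 X2 B).
apply: (measure_unique (@RGenOInfty.G R) (fun n => `]- n%:R, +oo[%classic)) => //.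
- exact: RGenOInfty.measurableE.
- move=> _ _ [a ->] [b ->]; exists (Num.max a b).
  by apply/seteqP; split=> y /=; rewrite !in_itv/= !andbT gt_max => /andP.
- by move=> n; exists (- n%:R).
- apply/seteqP; split => // y _; exists (Num.truncn `|y|).+1 => //=.
  rewrite in_itv/= andbT ltrNl (le_lt_trans _ (Num.Theory.truncnS_gt _))//.
  by rewrite -normrN ler_norm.
- move=> _ [a ->].
  by rewrite -[LHS]/(ccdf X1 a) -[RHS]/(ccdf X2 a) !ccdf_1_cdf eq_cdf.
- by move=> n; rewrite ltey_eq fin_num_measure.
Qed.

Lemma eq_law_ge0_integral (h : R -> \bar R) : measurable_fun setT h ->
  (forall y, 0 <= h y)%E ->
  (\int[P1]_w h (X1 w) = \int[P2]_w h (X2 w))%E.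
Proof.
move=> mh h0; rewrite -[LHS](ge0_integral_distribution X1 mh h0).
rewrite -[RHS](ge0_integral_distribution X2 mh h0).
by apply: eq_measure_integral => B mB _; exact: eq_law.
Qed.

Lemma eq_law_Lfun2 : (X1 : T1 -> R) \in Lfun P1 2%:E -> (X2 : T2 -> R) \in Lfun P2 2%:E.
Proof.
move=> /Lfun2_integrable_sqr /integrableP[_ h]; apply: Lfun2P => //.
have m : measurable_fun [set: R] (fun y => (y ^+ 2)%:E).
  by apply/measurable_EFinP; exact: measurable_funX.
rewrite -(eq_law_ge0_integral m) => [|y]; last by rewrite lee_fin sqr_ge0.
apply: le_lt_trans h; rewrite le_eqVlt; apply/orP; left; apply/eqP.
by apply: eq_integral => w _ /=; rewrite ger0_norm// sqr_ge0.
Qed.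

Lemma eq_law_expectation : (X1 : T1 -> R) \in Lfun P1 1 -> ('E_P1[X1] = 'E_P2[X2])%E.
Proof.
move=> /Lfun1_integrable X1L.
have X2L : P2.-integrable setT (EFin \o X2).
  apply/integrableP; split; first exact/measurable_EFinP.
  move/integrableP: X1L => [_]; apply: le_lt_trans.
  rewrite le_eqVlt; apply/orP; left; apply/eqP; apply/esym.
  apply: (@eq_law_ge0_integral (fun y => `|y%:E|)%E) => //.
  by apply: measurableT_comp => //.
rewrite unlock -[LHS](@integral_distribution _ _ _ _ _ P1 X1 EFin)//.
rewrite -[RHS](@integral_distribution _ _ _ _ _ P2 X2 EFin)//.
by apply: eq_measure_integral => B mB _; exact: eq_law.
Qed.

End law.

Section pmax.
Context {R : realType} {T : Type} (X : nat -> T -> R).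

Lemma pmax_leP j w a : (0 < j)%N ->
  pmax X j w <= a <-> (forall i, (i < j)%N -> X i w <= a).
Proof.
move=> j0; rewrite /pmax; split.
  by move=> /bigmax_leP[_ h] i ij; exact: (h (Ordinal ij)).
by move=> h; apply/bigmax_leP; split=> [|i _]; exact: h.
Qed.

Lemma le_pmax j w i : (i < j)%N -> X i w <= pmax X j w.
Proof. by move=> ij; exact: (le_bigmax _ _ (Ordinal ij)). Qed.

Lemma pmaxS j w : pmax X j.+1 w = Num.max (pmax X j w) (X j w).
Proof.
(* The default value of the big maximum makes the maximum of no variables equal to [X 0], so the
   recursion also holds at j = 0. *)
have [->|j0] := posnP j; first by rewrite /pmax big_ord_recl !big_ord0.
apply/eqP; rewrite eq_le; apply/andP; split.
  apply/pmax_leP => // i; rewrite ltnS leq_eqVlt => /predU1P[->|ij].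
    by rewrite le_max lexx orbT.
  by rewrite le_max le_pmax.
rewrite ge_max le_pmax// andbT; apply/pmax_leP => // i ij.
by apply: le_pmax; exact: ltnW.
Qed.

(** [X i] is the variable number i + 1, independent of the maximum of the first i, so this writes
    the spacing as a function of an independent pair. *)
Lemma pm_spacingE i w : pm_spacing X i w = Num.max 0 (X i w - pmax X i w).
Proof. by rewrite /pm_spacing pmaxS; case: (leP (pmax X i w)) => ?; case: leP => ?; lra. Qed.

End pmax.

Section iid.
Context {R : realType} d (T : measurableType d) (P : probability T R)
  (X : nat -> {RV P >-> R}) (F : R -> R).
Local Notation M := (pmax (fun i => X i : T -> R)).
Local Notation Z := (pm_spacing (fun i => X i : T -> R)).

Lemma measurable_pmax j : measurable_fun setT (M j).
Proof.
elim: j => [|j IH].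
  by rewrite (_ : M 0 = X 0%N)//; apply/funext => w; rewrite /pmax big_ord0.
rewrite (_ : M j.+1 = M j \max X j); last by apply/funext => w; rewrite pmaxS.
exact: measurable_maxr.
Qed.

Lemma measurable_pm_spacing j : measurable_fun setT (Z j).
Proof. by apply: measurable_funB; exact: measurable_pmax. Qed.

Hypothesis iidX : iid_cdf X F.

Lemma iid_le i a : P (X i @^-1` `]-oo, a]) = (F a)%:E.
Proof. by case: iidX => _ /(_ i a). Qed.

Lemma iid_gt i b : P (X i @^-1` `]b, +oo[) = (1 - F b)%:E.
Proof. by rewrite -[LHS]/(ccdf (X i) b) ccdf_1_cdf /cdf -[X in (1 - X)%E]/(P _) iid_le EFinB. Qed.

Lemma iid_cdf_itv a : 0 <= F a <= 1.
Proof.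
by rewrite -!lee_fin -(iid_le 0) measure_ge0 probability_le1//; exact: measurable_funPTI.
Qed.

Lemma measurable_pmax_le i a : measurable [set w | M i w <= a].
Proof.
rewrite (_ : [set w | _] = M i @^-1` `]-oo, a]); last by apply/seteqP; split=> w /=; rewrite in_itv.
by rewrite -[X in measurable X]setTI; exact: measurable_pmax.
Qed.

Lemma measurable_gt i b : measurable [set w | b < X i w].
Proof.
rewrite (_ : [set w | _] = X i @^-1` `]b, +oo[); first exact: measurable_funPTI.
by apply/seteqP; split=> w /=; rewrite in_itv/= andbT.
Qed.

Lemma prob_pmax_le i a : (0 < i)%N -> P [set w | M i w <= a] = (F a ^+ i)%:E.
Proof.
move=> i0; have [ind _] := iidX.
have := ind (iota 0 i) (fun _ => `]-oo, a]%classic) (iota_uniq _ _) (fun _ => measurable_itv _).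
under eq_bigr do rewrite iid_le.
rewrite big_const_seq count_predT size_iota => h.
rewrite [LHS](_ : _ = iter i (mule (F a)%:E) 1%E); last first.
  rewrite -h; congr (P _); apply/seteqP; split => w /=.
    move=> /(pmax_leP _ _ _ i0) hw j /=; rewrite mem_iota/= add0n => ji.
    by rewrite in_itv/= hw.
  move=> hw; apply/pmax_leP => // j ji.
  by have := hw j; rewrite /= mem_iota/= add0n in_itv/=; apply.
by elim: (i) => [|n IH]/=; rewrite ?expr0// IH exprS EFinM.
Qed.

(** A product of half-lines in i + 1 coordinates, so independence applies directly and no joint law
    is built. Both the lower bound on E[Z_i] and the slices of E[Z_i^2] are reduced to such
    events. *)
Lemma prob_pmax_le_gt i a b : (0 < i)%N ->
  P [set w | M i w <= a /\ b < X i w] = (F a ^+ i * (1 - F b))%:E.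
Proof.
move=> i0; have [ind _] := iidX.
pose B j := if (j < i)%N then `]-oo, a]%classic else `]b, +oo[%classic : set R.
have mB j : measurable (B j) by rewrite /B; case: ifP.
have := ind (iota 0 i.+1) B (iota_uniq _ _) mB.
rewrite -addn1 iotaD big_cat/= big_seq1 add0n {3}/B ltnn iid_gt.
rewrite big_seq; under eq_bigr.
  move=> j; rewrite mem_iota add0n => /andP[_ ji]; rewrite /B ji iid_le; over.
rewrite -big_seq big_const_seq count_predT size_iota => h.
rewrite [LHS](_ : _ = (iter i (mule (F a)%:E) 1 * (1 - F b)%:E)%E); last first.
  rewrite -h; congr (P _); apply/seteqP; split => w /=.
    move=> [/(pmax_leP _ _ _ i0) hw bX] j /=; rewrite mem_cat mem_iota/= add0n inE.
    rewrite /B; case: ifP => [ji _|_ /= /eqP ->]; first by rewrite /= in_itv/= hw.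
    by rewrite /= in_itv/= bX.
  move=> hw; split.
    apply/pmax_leP => // j ji.
    have := hw j; rewrite /= mem_cat mem_iota/= add0n ji => /(_ isT).
    by rewrite /B ji /= in_itv.
  have := hw i; rewrite /= mem_cat mem_seq1 eqxx orbT => /(_ isT).
  by rewrite /B ltnn /= in_itv/= andbT.
rewrite EFinM; congr (_ * _)%E.
by elim: (i) => [|n IH]/=; rewrite ?expr0// IH exprS EFinM.
Qed.

(* By the layer-cake formula: for nonincreasing h, the event h (M i) > r forces
   h (X j) > r for every j < i. *)
Lemma ge0_expectation_pmax_le i x0 (h : R -> R) : (0 < i)%N ->
  measurable_fun setT h -> (forall y, 0 <= h y) ->
  {homo h : y z / y <= z >-> z <= y} -> (forall y, x0 <= y -> h y = 0) ->
  (\int[P]_w (h (M i w))%:E <= (F x0 ^+ i.-1)%:E * \int[P]_w (h (X 0%N w))%:E)%E.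
Proof.
move=> i0 mh h0 hdec hx0; have [ind _] := iidX.
have mhM : measurable_fun setT (h \o M i).
  by apply: measurableT_comp => //; exact: measurable_pmax.
have mhX : measurable_fun setT (h \o X 0%N) by exact: measurableT_comp.
pose HM : {RV P >-> R} := mfun_Sub (mem_set mhM).
pose HX : {RV P >-> R} := mfun_Sub (mem_set mhX).
have := @ge0_expectation_ccdf _ _ _ P HM (fun w => h0 _).
have := @ge0_expectation_ccdf _ _ _ P HX (fun w => h0 _).
rewrite !expectation_def => eX eM.
rewrite [leLHS]eM [X in (_ * X)%E]eX -ge0_integralZl//; last 2 first.
- by apply: measurable_funTS; exact: ccdf_measurable.
- by rewrite lee_fin exprn_ge0//; case/andP: (iid_cdf_itv x0).
apply: ge0_le_integral => //.
- by apply: measurable_funTS; exact: ccdf_measurable.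
- by apply: measurable_funTS; apply: emeasurable_funM => //; exact: ccdf_measurable.
move=> r; rewrite /= in_itv/= andbT => r0.
pose B := h @^-1` `]r, +oo[.
have mB : measurable B by rewrite -[B]setTI; exact: mh.
have := ind (iota 0 i) (fun=> B) (iota_uniq _ _) (fun=> mB).
have iotaE : iota 0 i = 0%N :: iota 1 i.-1 by rewrite -{1}(prednK i0).
rewrite [in RHS]iotaE big_cons => hB.
(* As h vanishes from x0 on, h (X j) > r >= 0 forces X j below x0. This bounds i - 1 of the i
   independent factors; the remaining one rebuilds the integral of h (X 0). *)
have hP j : (P (X j @^-1` B) <= (F x0)%:E)%E.
  rewrite -(iid_le j) le_measure ?inE//; [exact: measurable_funPTI..|].
  move=> w; rewrite /B /= !in_itv/= andbT => rh; rewrite leNgt; apply/negP => /ltW /hx0 hw.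
  by move: rh; rewrite hw ltNge r0.
apply: (@le_trans _ _ (P (\bigcap_(j in [set j | j \in iota 0 i]) (X j @^-1` B)))).
  rewrite -[leLHS]/(P (HM @^-1` `]r, +oo[)) le_measure ?inE//.
  - exact: measurable_funPTI.
  - by apply: bigcap_measurableType => // j _; exact: measurable_funPTI.
  - move=> w /=; rewrite in_itv/= andbT => rh j /=; rewrite mem_iota add0n => /andP[_ ji].
    rewrite /B /= in_itv/= andbT; apply: lt_le_trans rh _; apply: hdec.
    exact: (@le_pmax _ _ (fun i => X i : T -> R)).
rewrite hB muleC -[X in (_ * X <= _)%E]/(ccdf HX r).
apply: lee_wpmul2r => //.
rewrite -[X in F x0 ^+ X](size_iota 1).
elim: (iota 1 i.-1) => [|j s IH]; first by rewrite big_nil expr0.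
rewrite big_cons/= exprS EFinM; apply: lee_pmul => //.
by elim/big_ind: _ => // x y; exact: mule_ge0.
Qed.

End iid.

(** * Pointwise slicing along the levels *)

Section dyadic_pointwise.
Context {R : realType} (x : nat -> R).
Hypothesis xinc : forall k, x k < x k.+1.

Lemma dyadic_mono : {homo x : k l / (k <= l)%N >-> k <= l}.
Proof. by apply: homo_leq => // [? ? ?|k]; [exact: le_trans|exact: ltW]. Qed.

Lemma mul_sqr_ge0 (c a : R) : 0 <= c -> 0 <= c * a ^+ 2.
Proof. by move=> c0; rewrite mulr_ge0// sqr_ge0. Qed.

Lemma mul_sqr_bool_ge0 (c a : R) (b : bool) : 0 <= c -> 0 <= c * a ^+ 2 * b%:R.
Proof. by move=> c0; rewrite mulr_ge0// mul_sqr_ge0. Qed.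

Lemma sqrDle (a b c : R) : 0 <= c -> c <= a + b -> c ^+ 2 <= 2 * a ^+ 2 + 2 * b ^+ 2.
Proof.
move=> c0 cab; have : c ^+ 2 <= (a + b) ^+ 2 by rewrite ler_sqr ?nnegrE// (le_trans c0).
by have := sqr_ge0 (a - b); nra.
Qed.

Lemma dyadic_locate (z : nat -> R) K (y : R) : z 0 < y -> y <= z K ->
  exists2 k, (k < K)%N & z k < y <= z k.+1.
Proof.
move=> z0y; elim: K => [|K IH]; first by rewrite leNgt z0y.
move=> yK; have [/IH[k kK h]|Ky] := leP y (z K).
  by exists k => //; exact: ltnW.
by exists K => //; rewrite Ky.
Qed.

(** The distance y - M is split at x_K, and once more at x_0 when M lies below it; each split costs
    a factor 2 through (a + b)^2 <= 2 a^2 + 2 b^2. The summands are arranged so that after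
    integration only probabilities of half-line events remain. *)
Lemma sqr_spacing_le K (M y : R) :
  Num.max 0 (y - M) ^+ 2 <=
  2 * Num.max 0 (y - x K) ^+ 2
  + \sum_(k < K) 2 * (x K - x k) ^+ 2 * ((M <= x k.+1) && (x k < y))%R%:R
  + 4 * (x K - x 0) ^+ 2 * (M <= x 0)%R%:R + 4 * Num.max 0 (x 0 - M) ^+ 2.
Proof.
set S := \sum_(k < K) _.
have S0 : 0 <= S by apply: sumr_ge0 => k _; exact: mul_sqr_bool_ge0.
have E0 : 0 <= 4 * (x K - x 0) ^+ 2 * (M <= x 0)%R%:R by exact: mul_sqr_bool_ge0.
have E1 : 0 <= 4 * Num.max 0 (x 0 - M) ^+ 2 by exact: mul_sqr_ge0.
have E2 : 0 <= 2 * Num.max 0 (y - x K) ^+ 2 by exact: mul_sqr_ge0.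
have [yM|My] := leP y M.
  by rewrite max_l ?subr_le0// expr0n/= !addr_ge0.
rewrite max_r ?subr_ge0 ?(ltW My)//.
have m0 : y - x K <= Num.max 0 (y - x K) by rewrite le_max lexx orbT.
have m00 : 0 <= Num.max 0 (y - x K) by rewrite le_max lexx.
have [KM|MK] := leP (x K) M.
  have : (y - M) ^+ 2 <= Num.max 0 (y - x K) ^+ 2.
    by rewrite ler_sqr ?nnegrE//; lra.
  by move: E2; set G := Num.max 0 (y - x K) ^+ 2; lra.
have : (y - M) ^+ 2 <= 2 * Num.max 0 (y - x K) ^+ 2 + 2 * (x K - M) ^+ 2.
  by apply: sqrDle; lra.
suff : 2 * (x K - M) ^+ 2 <= S + 4 * (x K - x 0) ^+ 2 * (M <= x 0)%R%:R +
    4 * Num.max 0 (x 0 - M) ^+ 2 by lra.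
have [M0|M0] := leP M (x 0).
  rewrite mulr1 (max_r (_ : 0 <= x 0 - M)) ?subr_ge0//.
  have : (x K - M) ^+ 2 <= 2 * (x K - x 0) ^+ 2 + 2 * (x 0 - M) ^+ 2 by apply: sqrDle; lra.
  by lra.
rewrite mulr0 addr0.
(* In the slice x_k < M <= x_(k+1), y > M gives y > x_k, so the k-th indicator equals 1. *)
have [k kK /andP[xk xk1]] := dyadic_locate M0 (ltW MK).
have : 2 * (x K - M) ^+ 2 <= S.
  rewrite /S (bigD1 (Ordinal kK))//= xk1 (lt_trans xk My)/= mulr1.
  rewrite -[leLHS]addr0 lerD//.
    by rewrite ler_wpM2l// ler_sqr ?nnegrE//; lra.
  by apply: sumr_ge0 => j _; exact: mul_sqr_bool_ge0.
by lra.
Qed.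

(* A finite partial sum suffices even for y above all levels, because every term
   is then at least (C d_K)^2. *)
Lemma sqr_excess_le (C rho : R) K (y : R) : 0 < C -> 1 < rho ->
  (forall n, x (K + n).+1 - x K <= C * rho ^+ n * (x K.+1 - x K)) ->
  exists N, Num.max 0 (y - x K) ^+ 2 <=
    \sum_(n < N) (C * rho ^+ n * (x K.+1 - x K)) ^+ 2 * (x (K + n)%N < y)%R%:R.
Proof.
move=> C0 r1 h; have [yK|Ky] := leP y (x K).
  by exists 0%N; rewrite max_l ?subr_le0// big_ord0 expr0n.
rewrite max_r ?subr_ge0 ?(ltW Ky)//.
have [[l hl]|nl] := pselect (exists l, y <= x (K + l)%N).
  have [|k kl /andP[xk yk]] := @dyadic_locate (fun n => x (K + n)%N) l y _ hl.
    by rewrite addn0.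
  exists k.+1; rewrite big_ord_recr/= xk mulr1.
  rewrite -[leLHS]add0r lerD//; first by apply: sumr_ge0 => j _; rewrite mulr_ge0// sqr_ge0.
  have d1 : y - x K <= C * rho ^+ k * (x K.+1 - x K).
    by apply: le_trans (h k); rewrite lerD2r -addnS.
  by rewrite ler_sqr// nnegrE ?subr_ge0 ?(ltW Ky)// (le_trans _ d1)// subr_ge0 ltW.
have yx n : x (K + n)%N < y by rewrite ltNge; apply/negP => yn; apply: nl; exists n.
have d0 : 0 < x K.+1 - x K by rewrite subr_gt0.
pose a := (C * (x K.+1 - x K)) ^+ 2; have a0 : 0 < a by rewrite exprn_gt0// mulr_gt0.
exists (Num.truncn ((y - x K) ^+ 2 / a)).+1.
apply: (@le_trans _ _ (\sum_(n < (Num.truncn ((y - x K) ^+ 2 / a)).+1) a)).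
  by rewrite sumr_const card_ord -mulr_natl -ler_pdivrMr// ltW// Num.Theory.truncnS_gt.
apply: ler_sum => n _; rewrite yx mulr1 /a.
rewrite ler_sqr ?nnegrE ?mulr_ge0 ?exprn_ge0 ?(ltW C0) ?(ltW d0) ?(le_trans ler01 (ltW r1))//.
by rewrite ler_wpM2r ?(ltW d0)// ler_peMr ?(ltW C0)// exprn_ege1// ltW.
Qed.

End dyadic_pointwise.

(** * Moments of the spacings *)

Lemma ge0_integral_indicZl {R : realType} d (T : measurableType d)
    (mu : {measure set T -> \bar R}) (c : R) (A : set T) : 0 <= c -> measurable A ->
  (\int[mu]_w (c * \1_A w)%:E = c%:E * mu A)%E.
Proof.
move=> c0 mA; under eq_integral do rewrite EFinM.
rewrite ge0_integralZl//; first by rewrite integral_indic// setIT.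
by apply/measurable_EFinP; exact: measurable_indic.
Qed.

Lemma sum_geometric_le {R : realFieldType} (a q : R) N : 0 <= a -> 0 <= q < 1 ->
  \sum_(n < N) a * q ^+ n <= a / (1 - q).
Proof.
move=> a0 /andP[q0 q1]; rewrite -mulr_sumr ler_wpM2l// -[leRHS]mul1r ler_pdivlMr ?subr_gt0//.
rewrite mulrC -opprB mulNr -subrX1 opprB lerBlDr lerDl exprn_ge0//.
Qed.

Section spacing_moments.
Context {R : realType} d (T : measurableType d) (P : probability T R)
  (X : nat -> {RV P >-> R}) (F : R -> R).
Local Notation M := (pmax (fun i => X i : T -> R)).
Local Notation Z := (pm_spacing (fun i => X i : T -> R)).
Hypothesis iidX : iid_cdf X F.

Lemma measurable_pmax_le_gt i a b : measurable [set w | M i w <= a /\ b < X i w].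
Proof.
by apply: measurableI; [exact: measurable_pmax_le|exact: measurable_gt].
Qed.

Lemma expectation_spacing_ge i a b : (0 < i)%N -> a <= b ->
  (((b - a) * (F a ^+ i * (1 - F b)))%:E <= 'E_P[Z i])%E.
Proof.
move=> i0 ab; rewrite EFinM -(prob_pmax_le_gt iidX a b i0) unlock.
set A := [set w | _]; have mA : measurable A by exact: measurable_pmax_le_gt.
have ab0 : 0 <= b - a by rewrite subr_ge0.
rewrite -(ge0_integral_indicZl P ab0 mA).
apply: ge0_le_integral => //.
- by move=> w _; rewrite lee_fin mulr_ge0.
- by apply/measurable_EFinP; apply: measurable_funM => //; exact: measurable_indic.
- by apply/measurable_EFinP; exact: measurable_pm_spacing.
move=> w _; rewrite lee_fin indicE pm_spacingE.
case: (boolP (w \in A)) => [|_]; last by rewrite mulr0 le_max lexx.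
rewrite inE /A/= mulr1 => -[Ma bX]; rewrite le_max; apply/orP; right; lra.
Qed.

Lemma prob_gt i b : P [set w | b < X i w] = (1 - F b)%:E.
Proof.
rewrite -(iid_gt iidX i b); congr (P _).
by apply/seteqP; split => w /=; rewrite in_itv/= andbT.
Qed.

(** The n-th term has expectation a q^n with q = rho^2 / 2 < 1, because the tail at x_(K+n) is u /
    2^(K+n). The number of terms needed depends on the sample point, hence the infinite series,
    integrated termwise. *)
Lemma integral_sqr_excess_le (x : nat -> R) (u C rho B : R) i K :
  dyadic_levels F x u C rho B -> 0 < C -> 1 < rho -> rho ^+ 2 < 2 ->
  (\int[P]_w (Num.max 0 (X i w - x K) ^+ 2)%:E <=
   (C ^+ 2 * (x K.+1 - x K) ^+ 2 * (u / 2 ^+ K) / (1 - rho ^+ 2 / 2))%:E)%E.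
Proof.
move=> [/andP[u0 uh] Fx xinc hup _] C0 r1 r2.
pose t n w : \bar R := ((C * rho ^+ n * (x K.+1 - x K)) ^+ 2 *
  \1_[set w | x (K + n)%N < X i w] w)%:E.
have t0 n w : (0 <= t n w)%E by rewrite lee_fin mulr_ge0// sqr_ge0.
have mt n : measurable_fun setT (t n).
  apply/measurable_EFinP; apply: measurable_funM => //; apply: measurable_indic.
  exact: measurable_gt.
pose a := C ^+ 2 * (x K.+1 - x K) ^+ 2 * (u / 2 ^+ K); pose q := rho ^+ 2 / 2.
have a0 : 0 <= a.
  apply: mulr_ge0; last by rewrite divr_ge0 ?exprn_ge0 ?(ltW u0).
  by apply: mul_sqr_ge0; exact: sqr_ge0.
have q0 : 0 <= q < 1 by rewrite /q divr_ge0 ?sqr_ge0//=; lra.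
have It n : (\int[P]_w t n w = (a * q ^+ n)%:E)%E.
  rewrite ge0_integral_indicZl ?sqr_ge0//; last exact: measurable_gt.
  rewrite [X in (_ * X)%E](prob_gt i _) Fx -EFinM; congr (_%:E).
  rewrite /a /q exprD exprMn exprMn -exprM mulnC exprM expr_div_n.
  by field; rewrite !expf_neq0.
apply: (@le_trans _ _ (\int[P]_w (\sum_(n <oo) t n w)%E)%E).
  apply: ge0_le_integral => //.
  - by move=> w _; rewrite lee_fin sqr_ge0.
  - apply/measurable_EFinP; apply: measurable_funX; apply: measurable_maxr => //.
    exact: measurable_funB.
  - exact: ge0_emeasurable_sum.
  move=> w _; have [N hN] := sqr_excess_le xinc (X i w) C0 r1 (hup K).
  apply: le_trans (nneseries_lim_ge N _); last by move=> n _ _; exact: t0.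
  rewrite big_mkord sumEFin lee_fin; apply: (le_trans hN).
  apply: ler_sum => n _; rewrite indicE le_eqVlt; apply/orP; left; apply/eqP.
  by congr (_ * (nat_of_bool _)%:R); apply/idP/idP; rewrite inE.
rewrite integral_nneseries//.
under eq_eseriesr do rewrite It.
apply: lime_le.
  by apply: is_cvg_nneseries => n _ _; rewrite lee_fin mulr_ge0// exprn_ge0//; case/andP: q0.
by near=> N; rewrite big_mkord sumEFin lee_fin -/a -/q sum_geometric_le.
Unshelve. all: end_near.
Qed.

(** The last summand isolates the lower tail of F; it stays an extended real because its finiteness
    is established only later, from the second moment. *)
Lemma integral_sqr_spacing_le (x : nat -> R) (u C rho B : R) i K : (0 < i)%N ->
  dyadic_levels F x u C rho B -> 0 < C -> 1 < rho -> rho ^+ 2 < 2 ->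
  (\int[P]_w (Z i w ^+ 2)%:E <=
   (2 * (C ^+ 2 * (x K.+1 - x K) ^+ 2 * (u / 2 ^+ K) / (1 - rho ^+ 2 / 2))
    + \sum_(k < K) 2 * (x K - x k) ^+ 2 * (F (x k.+1) ^+ i * (1 - F (x k)))
    + 4 * (x K - x 0) ^+ 2 * F (x 0) ^+ i)%:E
   + 4%:E * ((F (x 0) ^+ i.-1)%:E * \int[P]_w (Num.max 0 (x 0 - X 0%N w) ^+ 2)%:E))%E.
Proof.
move=> i0 lev C0 r1 r2; have [_ _ xinc _ _] := lev.
pose A k := [set w | M i w <= x k.+1 /\ x k < X i w].
pose A0 := [set w | M i w <= x 0].
have mA k : measurable (A k) by exact: measurable_pmax_le_gt.
have mA0 : measurable A0 by exact: measurable_pmax_le.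
pose f1 w := (2 * Num.max 0 (X i w - x K) ^+ 2)%:E.
pose f2 k w := (2 * (x K - x k) ^+ 2 * \1_(A k) w)%:E.
pose f3 w := (4 * (x K - x 0) ^+ 2 * \1_A0 w)%:E.
pose f4 w := (4 * Num.max 0 (x 0 - M i w) ^+ 2)%:E.
have f10 w : (0 <= f1 w)%E by rewrite lee_fin mul_sqr_ge0.
have f20 k w : (0 <= f2 k w)%E by rewrite lee_fin mul_sqr_bool_ge0.
have f30 w : (0 <= f3 w)%E by rewrite lee_fin mul_sqr_bool_ge0.
have f40 w : (0 <= f4 w)%E by rewrite lee_fin mul_sqr_ge0.
have mG1 : measurable_fun setT (fun w => (Num.max 0 (X i w - x K) ^+ 2)%:E).
  apply/measurable_EFinP; apply: measurable_funX; apply: measurable_maxr => //.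
  exact: measurable_funB.
have mG4 : measurable_fun setT (fun w => (Num.max 0 (x 0 - M i w) ^+ 2)%:E).
  apply/measurable_EFinP; apply: measurable_funX; apply: measurable_maxr => //.
  by apply: measurable_funB => //; exact: measurable_pmax.
have mf1 : measurable_fun setT f1.
  by rewrite /f1; under eq_fun do rewrite EFinM; exact: measurable_funeM.
have mf4 : measurable_fun setT f4.
  by rewrite /f4; under eq_fun do rewrite EFinM; exact: measurable_funeM.
have mf2 k : measurable_fun setT (f2 k).
  by apply/measurable_EFinP; apply: measurable_funM => //; exact: measurable_indic.
have mf3 : measurable_fun setT f3.
  by apply/measurable_EFinP; apply: measurable_funM => //; exact: measurable_indic.
apply: (@le_trans _ _ (\int[P]_w (f1 w + \sum_(k < K) f2 k w + f3 w + f4 w))%E).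
  apply: ge0_le_integral => //.
  - by move=> w _; rewrite lee_fin sqr_ge0.
  - by apply/measurable_EFinP; apply: measurable_funX; exact: measurable_pm_spacing.
  - by do 3 apply: emeasurable_funD => //; exact: emeasurable_sum.
  move=> w _; rewrite sumEFin -!EFinD lee_fin pm_spacingE.
  apply: le_trans (sqr_spacing_le x K (M i w) (X i w)) _.
  rewrite le_eqVlt; apply/orP; left; apply/eqP; congr (_ + _ + _ + _).
    apply: eq_bigr => k _; rewrite indicE; congr (_ * (nat_of_bool _)%:R).
    by apply/andP/idP; rewrite inE.
  by rewrite indicE; congr (_ * (nat_of_bool _)%:R); apply/idP/idP; rewrite inE.
have s0 w : (0 <= \sum_(k < K) f2 k w)%E by apply: sume_ge0.
have ms : measurable_fun setT (fun w => \sum_(k < K) f2 k w)%E by exact: emeasurable_sum.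
rewrite ge0_integralD//; last 2 first.
- by move=> w _; rewrite !adde_ge0.
- by do 2 apply: emeasurable_funD => //.
rewrite ge0_integralD//; last 2 first.
- by move=> w _; rewrite !adde_ge0.
- by apply: emeasurable_funD.
rewrite ge0_integralD// ge0_integral_sum//.
rewrite !EFinD -sumEFin; apply: leeD; first apply: leeD; first apply: leeD.
- rewrite /f1; under eq_integral do rewrite EFinM.
  rewrite ge0_integralZl//; last by move=> w _; rewrite lee_fin sqr_ge0.
  by rewrite EFinM lee_wpmul2l// (integral_sqr_excess_le i K lev).
- apply: lee_sum => k _; rewrite ge0_integral_indicZl//; last exact: mul_sqr_ge0.
  by rewrite /A [X in (_ * X <= _)%E](prob_pmax_le_gt iidX _ _ i0) -EFinM.
- rewrite ge0_integral_indicZl//; last exact: mul_sqr_ge0.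
  by rewrite /A0 [X in (_ * X <= _)%E](prob_pmax_le iidX _ i0) -EFinM.
- rewrite /f4; under eq_integral do rewrite EFinM.
  rewrite ge0_integralZl//; last by move=> w _; rewrite lee_fin sqr_ge0.
  rewrite lee_wpmul2l//.
  apply: (ge0_expectation_pmax_le iidX i0 (h := fun y => Num.max 0 (x 0 - y) ^+ 2)).
  + by apply: measurable_funX; apply: measurable_maxr => //; exact: measurable_funB.
  + by move=> y; exact: sqr_ge0.
  + move=> y z yz; have h0 v : 0 <= Num.max 0 (x 0 - v) by rewrite le_max lexx.
    by rewrite ler_sqr ?nnegrE// ge_max h0 le_max lerD2l lerN2 yz orbT.
  + by move=> y xy; rewrite max_l ?subr_le0// expr0n.
Qed.

End spacing_moments.

(** * Numerical estimates at the scale 2^K *)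

Section ratio.
Context {R : realType}.

(** With t = 2^n and 2 D <= 2^p one has D^n t <= t^p, while exp(s t) >= (s t)^p / p! by the
    exponential series. *)
Lemma exp_decay_le (D s : R) : 0 < D -> 0 < s ->
  exists2 Q, 0 <= Q & forall n, D ^+ n * expR (- (s * 2 ^+ n)) <= Q / 2 ^+ n.
Proof.
move=> D0 s0; pose p := (Num.truncn (2 * D)).+1.
have Dp : 2 * D <= 2 ^+ p.
  apply: ltW; apply: (lt_le_trans (Num.Theory.truncnS_gt _)).
  by rewrite -natrX ler_nat ltnW// ltn_expl.
have fp : (0 : R) < p`!%:R by rewrite ltr0n fact_gt0.
exists (p`!%:R / s ^+ p); first by rewrite divr_ge0 ?exprn_ge0 ?ltW.
move=> n; set t : R := 2 ^+ n; have t0 : 0 < t by rewrite exprn_gt0.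
have st : 0 <= s * t by rewrite mulr_ge0 ?ltW.
have h : (s * t) ^+ p <= p`!%:R * expR (s * t).
  by rewrite -ler_pdivrMl// mulrC; apply: le_trans (expR_ge1Dxn p.-1 st); rewrite lerDr.
have h2 : D ^+ n * t <= t ^+ p.
  rewrite /t mulrC -exprMn -exprM mulnC exprM.
  by rewrite lerXn2r ?nnegrE ?exprn_ge0// mulr_ge0// ltW.
rewrite expRN ler_pdivrMr ?expR_gt0//.
have sp0 : 0 < s ^+ p by rewrite exprn_gt0.
have -> : p`!%:R / s ^+ p / t * expR (s * t) = p`!%:R * expR (s * t) / (s ^+ p * t).
  by field; rewrite !gt_eqF.
rewrite ler_pdivlMr ?mulr_gt0//; apply: le_trans h.
by rewrite exprMn mulrCA ler_wpM2l// ltW.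
Qed.

Lemma onem_pow_ge (t : R) n : 0 <= t <= 1 -> 1 - n%:R * t <= (1 - t) ^+ n.
Proof.
move=> /andP[t0 t1]; elim: n => [|n IH]; first by rewrite mul0r subr0 expr0.
have : (1 - n%:R * t) * (1 - t) <= (1 - t) ^+ n.+1.
  by rewrite exprSr ler_wpM2r// subr_ge0.
apply: le_trans; rewrite -natr1.
have : 0 <= n%:R * t ^+ 2 by rewrite mulr_ge0// sqr_ge0.
by rewrite expr2; lra.
Qed.

Lemma sum_half_le K : \sum_(k < K) ((2 ^+ (K - k))^-1 : R) <= 1.
Proof.
elim: K => [|K IH]; first by rewrite big_ord0.
rewrite big_ord_recr/= subSnn expr1.
rewrite (eq_bigr (fun k : 'I_K => (2 ^+ (K - k))^-1 / 2 : R)); last first.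
  by move=> k _; rewrite subSn ?(ltnW (ltn_ord k))// exprSr invfM.
by rewrite -mulr_suml; lra.
Qed.

Lemma onem_pow_le (t : R) n : t <= 1 -> (1 - t) ^+ n <= expR (- (t * n%:R)).
Proof.
move=> t1; rewrite -mulNr expRM_natr lerXn2r ?nnegrE ?subr_ge0 ?expR_ge0//.
exact: expR_ge1Dx.
Qed.

(** By Bernoulli's inequality (1 - u / 2^K)^(2^K) >= 1 - u >= 1/2. As i <= 2 * 2^K, squaring gives
    F(x_K)^i >= 1/4, and the tail u / 2^(K+1) supplies the remaining factor 1/2 of u / 8. *)
Lemma dyadic_gap_lower (F : R -> R) x (u C rho B : R) i K : (i < 2 ^ K.+1)%N ->
  dyadic_levels F x u C rho B ->
  u / 8 * (x K.+1 - x K) / 2 ^+ K <=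
  (x K.+1 - x K) * (F (x K) ^+ i * (1 - F (x K.+1))).
Proof.
move=> iK1 [/andP[u0 uh] Fx xinc _ _].
have iK : (i <= 2 * 2 ^ K)%N by rewrite -expnS ltnW.
have p0 : (0 : R) < 2 ^+ K by rewrite exprn_gt0.
have v : 0 <= u / 2 ^+ K <= 1.
  rewrite divr_ge0 ?(ltW u0) ?(ltW p0)//= ler_pdivrMr// mul1r.
  by rewrite (@le_trans _ _ 1)//; [lra|rewrite exprn_ege1// ler1n].
have h1 : (1 / 4 : R) <= F (x K) ^+ i.
  rewrite Fx; apply: (@le_trans _ _ ((1 - u / 2 ^+ K) ^+ (2 * 2 ^ K))); last first.
    by apply: ler_wiXn2l => //; lra.
  rewrite mulnC exprM.
  have b : 1 - u <= (1 - u / 2 ^+ K) ^+ (2 ^ K).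
    apply: le_trans (onem_pow_ge _ v); rewrite natrX lerD2l lerN2 mulrC divfK//.
  have : (1 - u) ^+ 2 <= ((1 - u / 2 ^+ K) ^+ (2 ^ K)) ^+ 2.
    by rewrite lerXn2r ?nnegrE ?exprn_ge0//; lra.
  by apply: le_trans; rewrite expr2; nra.
rewrite (Fx K.+1) opprB addrCA subrr addr0 exprSr invfM.
have -> : u / 8 * (x K.+1 - x K) / 2 ^+ K = (x K.+1 - x K) * (1 / 4 * (u * ((2 ^+ K)^-1 / 2))).
  by field.
rewrite ler_wpM2l ?subr_ge0 ?(ltW (xinc _))// ler_wpM2r//.
by rewrite !mulr_ge0 ?(ltW u0)// invr_ge0 ltW.
Qed.

(** With n = K - k, the k-th slice is at most a constant times (d_K^2 / 2^K) (2 B^2)^n exp(-(u/2)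
    2^n), hence of order 2^(-n), and the sum over k costs only a constant. [G1] to [G4] bound the
    four summands in order. *)
Lemma dyadic_sum_upper (F : R -> R) x (u C rho B J : R) :
  dyadic_levels F x u C rho B -> 0 < C -> 1 < rho -> rho ^+ 2 < 2 -> 2 <= B -> 0 <= J ->
  exists2 G, 0 <= G & forall i K, (0 < i)%N -> (2 ^ K <= i)%N ->
   2 * (C ^+ 2 * (x K.+1 - x K) ^+ 2 * (u / 2 ^+ K) / (1 - rho ^+ 2 / 2))
    + \sum_(k < K) 2 * (x K - x k) ^+ 2 * (F (x k.+1) ^+ i * (1 - F (x k)))
    + 4 * (x K - x 0) ^+ 2 * F (x 0) ^+ i + 4 * (F (x 0) ^+ i.-1 * J)
  <= G * ((x K.+1 - x K) ^+ 2 / 2 ^+ K).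
Proof.
move=> [/andP[u0 uh] Fx xinc _ hdown] C0 r1 r2 B2 J0.
have B0 : 0 < B by lra.
(* B^2 comes from the squared distance x_K - x_k, and the 2 from the tail 1 - F(x_k) = u 2^n /
   2^K. *)
have D0 : 0 < 2 * B ^+ 2 by rewrite mulr_gt0// exprn_gt0.
have u20 : 0 < u / 2 by rewrite divr_gt0.
have [Q Q0 hQ] := exp_decay_le D0 u20.
have d00 : 0 < x 1 - x 0 by rewrite subr_gt0.
pose G1 := 2 * (C ^+ 2 * u / (1 - rho ^+ 2 / 2)).
pose G2 := 2 * C ^+ 2 * u * Q.
pose G3 := 4 * C ^+ 2 * Q.
pose G4 := 8 * J * ((C + 1) / (x 1 - x 0)) ^+ 2 * Q.
have G40 : 0 <= G4 by rewrite mulr_ge0// mul_sqr_ge0// mulr_ge0.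
have G30 : 0 <= G3 by rewrite mulr_ge0// mul_sqr_ge0.
have G20 : 0 <= G2 by rewrite mulr_ge0// mulr_ge0 ?(ltW u0)// mul_sqr_ge0.
have G10 : 0 <= G1 by rewrite mulr_ge0// divr_ge0 ?mulr_ge0 ?sqr_ge0 ?(ltW u0)//; lra.
exists (G1 + G2 + G3 + G4); first by rewrite !addr_ge0.
move=> i K i0 Ki; set dK := x K.+1 - x K; set L := dK ^+ 2 / 2 ^+ K.
have dK0 : 0 < dK by rewrite subr_gt0.
have p2 n : (0 : R) < 2 ^+ n by rewrite exprn_gt0.
have Kir : (2 ^+ K : R) <= i%:R by rewrite -natrX ler_nat.
have down k n : K = (k + n)%N -> (x K - x k) ^+ 2 <= C ^+ 2 * dK ^+ 2 * (B ^+ 2) ^+ n.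
  move=> Kkn; have := hdown k n; rewrite -Kkn -/dK => h.
  have -> : C ^+ 2 * dK ^+ 2 * (B ^+ 2) ^+ n = (C * B ^+ n * dK) ^+ 2.
    by rewrite -exprM mulnC exprM !exprMn; ring.
  rewrite ler_sqr ?nnegrE// ?(ltW dK0) ?subr_ge0 ?(dyadic_mono xinc)// ?Kkn ?leq_addr//.
  by rewrite !mulr_ge0 ?exprn_ge0 ?(ltW dK0) ?(ltW C0) ?(ltW B0).
have u1 k : u / 2 ^+ k <= 1.
  rewrite ler_pdivrMr// mul1r (@le_trans _ _ 1)//; first by lra.
  by rewrite exprn_ege1// ler1n.
have Fpow k n : K = (k + n)%N -> F (x k.+1) ^+ i <= expR (- (u / 2 * 2 ^+ n)).
  move=> Kkn; rewrite Fx; apply: le_trans (onem_pow_le i (u1 k.+1)) _.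
  rewrite ler_expR lerN2.
  have -> : u / 2 * 2 ^+ n = u / 2 ^+ k.+1 * 2 ^+ K.
    by rewrite Kkn exprD exprS; field.
  by rewrite ler_wpM2l// divr_ge0// ltW.
have F0pow : F (x 0) ^+ i <= expR (- (u / 2 * 2 ^+ K)).
  rewrite Fx; apply: le_trans (onem_pow_le i (u1 0%N)) _.
  rewrite ler_expR lerN2 expr0 divr1; apply: ler_pM => //; try lra.
have F00 : 1 / 2 <= F (x 0) by rewrite Fx expr0 divr1; lra.
have BK n : (B ^+ 2) ^+ n * expR (- (u / 2 * 2 ^+ n)) <= Q / 2 ^+ n.
  apply: le_trans (hQ n); rewrite ler_wpM2r ?expR_ge0//.
  by rewrite lerXn2r ?nnegrE ?sqr_ge0 ?(ltW D0)// ler_peMl ?sqr_ge0// ler1n.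
have -> : (G1 + G2 + G3 + G4) * L = G1 * L + G2 * L + G3 * L + G4 * L by ring.
apply: lerD; first apply: lerD; first apply: lerD.
- by rewrite /G1 /L le_eqVlt; apply/orP; left; apply/eqP; field; rewrite !gt_eqF//; lra.
- apply: (@le_trans _ _ (\sum_(k < K) G2 * L / 2 ^+ (K - k))); last first.
    by rewrite -mulr_sumr ler_piMr ?sum_half_le// mulr_ge0// divr_ge0 ?sqr_ge0// ltW.
  apply: ler_sum => k _; have kK : K = (k + (K - k))%N by rewrite subnKC// ltnW.
  have h1 := down _ _ kK; have h2 := Fpow _ _ kK; have h3 := hQ (K - k)%N.
  have -> : 1 - F (x k) = u * 2 ^+ (K - k) / 2 ^+ K.
    have p : (2 ^+ K : R) = 2 ^+ k * 2 ^+ (K - k) by rewrite -exprD -kK.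
    have := p2 k; have := p2 (K - k)%N; rewrite Fx p.
    by move: (2 ^+ k) (2 ^+ (K - k)) => a b b0 a0; field; rewrite !gt_eqF.
  set E := expR _ in h2 h3; set n := (K - k)%N in h1 h2 h3 *.
  have e1 : 2 * (x K - x k) ^+ 2 * (F (x k.+1) ^+ i * (u * 2 ^+ n / 2 ^+ K)) <=
            2 * (C ^+ 2 * dK ^+ 2 * (B ^+ 2) ^+ n) * (E * (u * 2 ^+ n / 2 ^+ K)).
    apply: ler_pM; first exact: mul_sqr_ge0.
    - rewrite mulr_ge0 ?divr_ge0 ?mulr_ge0 ?(ltW u0) ?(ltW (p2 _))// exprn_ge0// Fx subr_ge0.
      exact: u1.
    - by rewrite ler_wpM2l.
    - by rewrite ler_wpM2r// divr_ge0 ?mulr_ge0 ?(ltW u0) ?(ltW (p2 _)).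
  apply: (le_trans e1).
  have -> : 2 * (C ^+ 2 * dK ^+ 2 * (B ^+ 2) ^+ n) * (E * (u * 2 ^+ n / 2 ^+ K)) =
     2 * C ^+ 2 * u * L * ((2 * B ^+ 2) ^+ n * E).
    rewrite [(2 * B ^+ 2) ^+ n]exprMn /L; have := p2 K.
    move: (2 ^+ n) (2 ^+ K) ((B ^+ 2) ^+ n) => a b c b0.
    by field; rewrite gt_eqF.
  have -> : G2 * L / 2 ^+ n = 2 * C ^+ 2 * u * L * (Q / 2 ^+ n).
    by rewrite /G2; move: L (2 ^+ n)^-1 => l z; ring.
  rewrite ler_wpM2l// mulr_ge0 ?divr_ge0 ?sqr_ge0 ?(ltW (p2 _))// mulr_ge0 ?(ltW u0)//.
  exact: mul_sqr_ge0.
- have h1 := down 0%N K erefl.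
  apply: (@le_trans _ _ (4 * (C ^+ 2 * dK ^+ 2 * (B ^+ 2) ^+ K) * expR (- (u / 2 * 2 ^+ K)))).
    apply: ler_pM => //; [exact: mul_sqr_ge0| |by rewrite ler_wpM2l].
    by rewrite exprn_ge0//; lra.
  have -> : 4 * (C ^+ 2 * dK ^+ 2 * (B ^+ 2) ^+ K) * expR (- (u / 2 * 2 ^+ K)) =
    4 * C ^+ 2 * dK ^+ 2 * ((B ^+ 2) ^+ K * expR (- (u / 2 * 2 ^+ K))) by ring.
  have -> : G3 * L = 4 * C ^+ 2 * dK ^+ 2 * (Q / 2 ^+ K).
    by rewrite /G3 /L; move: (2 ^+ K)^-1 => z; ring.
  by rewrite ler_wpM2l// mulr_ge0 ?sqr_ge0// mul_sqr_ge0.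
(* The bound on the lower tail does not involve d_K, so d_K is bounded below by a multiple of x_1 -
   x_0. The constant is C + 1 because x_1 <= x_(K+1) adds one gap d_K to x_K - x_0. *)
- have h1 : (x 1 - x 0) ^+ 2 <= (C + 1) ^+ 2 * dK ^+ 2 * (B ^+ 2) ^+ K.
    have -> : (C + 1) ^+ 2 * dK ^+ 2 * (B ^+ 2) ^+ K = ((C + 1) * B ^+ K * dK) ^+ 2.
      by rewrite -exprM mulnC exprM !exprMn; ring.
    have BK1 : 1 <= B ^+ K by rewrite exprn_ege1//; lra.
    have h : x 1 - x 0 <= (C + 1) * B ^+ K * dK.
      have := hdown 0%N K; rewrite add0n -/dK => h.
      have m : x 1 <= x K.+1 by apply: (dyadic_mono xinc).
      have : 1 * dK <= B ^+ K * dK by rewrite ler_wpM2r// ltW.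
      by rewrite /dK in h *; lra.
    by rewrite ler_sqr ?nnegrE// ?(ltW d00) ?(le_trans (ltW d00)).
  (* Lowering the exponent by one costs a factor 2, as F(x_0) >= 1/2. *)
  have h2 : F (x 0) ^+ i.-1 <= 2 * expR (- (u / 2 * 2 ^+ K)).
    have : F (x 0) ^+ i.-1 * (1 / 2) <= F (x 0) ^+ i.
      rewrite -[in leRHS](prednK i0) exprSr ler_wpM2l// exprn_ge0//; lra.
    by lra.
  set E := expR _ in h2; have E0 : 0 <= E by exact: expR_ge0.
  apply: (@le_trans _ _ (4 * (2 * E * J))).
    by rewrite ler_wpM2l// ler_wpM2r.
  have h3 : E <= ((C + 1) / (x 1 - x 0)) ^+ 2 * dK ^+ 2 * (Q / 2 ^+ K).
    have : (x 1 - x 0) ^+ 2 * E <= (C + 1) ^+ 2 * dK ^+ 2 * (Q / 2 ^+ K).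
      apply: (@le_trans _ _ ((C + 1) ^+ 2 * dK ^+ 2 * (B ^+ 2) ^+ K * E)).
        by rewrite ler_wpM2r.
      by rewrite -mulrA ler_wpM2l ?BK// mulr_ge0 ?sqr_ge0.
    rewrite mulrC -ler_pdivlMr ?exprn_gt0// => /le_trans; apply.
    rewrite le_eqVlt; apply/orP; left; apply/eqP; move: d00 (p2 K).
    by move: (x 1 - x 0) (2 ^+ K) => a b a0 b0; field; rewrite !gt_eqF.
  have -> : G4 * L = 8 * J * (((C + 1) / (x 1 - x 0)) ^+ 2 * dK ^+ 2 * (Q / 2 ^+ K)).
    rewrite /G4 /L; move: d00 (p2 K).
    by move: (x 1 - x 0) (2 ^+ K) => a b a0 b0; field; rewrite !gt_eqF.
  have -> : 4 * (2 * E * J) = 8 * J * E by ring.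
  by rewrite ler_wpM2l// mulr_ge0.
Qed.

End ratio.

(** * Linear estimators built from spacings *)

Section estimators.
Context {R : realType} {T : Type}.
Implicit Types (X : nat -> T -> R) (a : nat -> R).

(* Abel summation: these are the coefficients of sum_i a_i Z_i on the partial
   maxima, provided a 0 = 0. *)
Definition spacing_coef n a (j : nat) : R := a j - (if (j.+1 < n)%N then a j.+1 else 0).

Lemma pm_est_spacing n a X w : a 0%N = 0 ->
  pm_est n (spacing_coef n a) X w = \sum_(i < n) a i * pm_spacing X i w.
Proof.
move=> a0; rewrite /pm_est /spacing_coef /pm_spacing.
under eq_bigr do rewrite mulrBl.
under [RHS]eq_bigr do rewrite mulrBr.
rewrite !sumrB; congr (_ - _).
case: n => [|n]; first by rewrite !big_ord0.
rewrite big_ord_recr big_ord_recl /= ltnn mul0r addr0 a0 mul0r add0r.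
by apply: eq_bigr => i _; rewrite ltnS ltn_ord.
Qed.

Lemma pmax_affine (t1 t2 : R) X Y j w : 0 < t2 -> (forall i, X i w = t1 + t2 * Y i w) ->
  pmax X j w = t1 + t2 * pmax Y j w.
Proof.
move=> t20 XY; elim: j => [|j IH]; first by rewrite /pmax !big_ord0.
rewrite !pmaxS IH XY -addr_maxr; congr (_ + _); rewrite maxr_pMr//; exact: ltW.
Qed.

Lemma pm_spacing_affine (t1 t2 : R) X Y j w : 0 < t2 -> (forall i, X i w = t1 + t2 * Y i w) ->
  pm_spacing X j w = t2 * pm_spacing Y j w.
Proof. by move=> t20 XY; rewrite /pm_spacing !(pmax_affine _ t20 XY); lra. Qed.

End estimators.

Section standardize.
Context {R : realType} d (T : measurableType d) (P : probability T R)
  (X : nat -> {RV P >-> R}) (F : R -> R) (t1 t2 : R).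
Hypothesis t20 : 0 < t2.

Lemma measurable_standardized i : measurable_fun setT (fun w => (X i w - t1) / t2).
Proof. by apply: measurable_funM => //; exact: measurable_funB. Qed.

Definition standardized i : {RV P >-> R} := mfun_Sub (mem_set (measurable_standardized i)).

Lemma standardizedK i w : X i w = t1 + t2 * standardized i w.
Proof. by rewrite /standardized /= mulrC divfK ?gt_eqF// addrC subrK. Qed.

Lemma iid_standardized : iid_cdf X (locscale F t1 t2) -> iid_cdf standardized F.
Proof.
move=> [ind cdfX]; split.
  move=> s B us mB.
  have := ind s (fun i => (fun y => (y - t1) / t2) @^-1` B i) us.
  apply => i; rewrite -[X in measurable X]setTI.
  by apply: measurable_funM => //; exact: measurable_funB.
move=> i r; have := cdfX i (t1 + t2 * r); rewrite /locscale addrAC subrr add0r.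
rewrite mulrAC divff ?gt_eqF// mul1r => <-.
rewrite /cdf /distribution /pushforward; congr (P _).
by apply/seteqP; split => w /=; rewrite !in_itv/= (ler_pdivrMr _ _ t20) lerBlDl (mulrC r).
Qed.

End standardize.

(** * Variances, square integrability and invariance of the moments *)

Section variance_sum.
Context {R : realType} d (T : measurableType d) (P : probability T R).
Local Open Scope ereal_scope.

Lemma Lfun2_sum n (a : nat -> R) (Y : nat -> T -> R) :
  (forall i, Y i \in Lfun P 2%:E) -> (fun w => \sum_(i < n) a i * Y i w)%R \in Lfun P 2%:E.
Proof.
move=> YL; elim: n => [|n IH].
  by under eq_fun do rewrite big_ord0; exact: Lfun_cst.
rewrite (_ : (fun _ => _) = (fun w => \sum_(i < n) a i * Y i w)%R \+ (a n \o* Y n))%R.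
  rewrite rpredD ?lee1n// => p1; apply: Lfun_scale; [exact: ler1n|exact: YL].
by apply/funext => w; rewrite big_ord_recr/= (mulrC (Y n w)).
Qed.

(** Nonnegative weights keep every cross term nonpositive. The auxiliary induction bounds the
    covariance of a partial sum with a later variable, which is the cross term created by adding one
    summand. *)
Lemma variance_sum_le n (a : nat -> R) (Y : nat -> T -> R) :
  (forall i, Y i \in Lfun P 2%:E) -> (forall i, 0 <= a i)%R ->
  (forall i j, i != j -> covariance P (Y i) (Y j) <= 0) ->
  'V_P[(fun w => \sum_(i < n) a i * Y i w)%R] <= \sum_(i < n) (a i ^+ 2)%:E * 'V_P[Y i].
Proof.
move=> YL a0 cov; have Pfin : P setT \is a fin_num := fin_num_measure P _ measurableT.
have Y1 i := Lfun_subset12 Pfin (YL i).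
have covS m j : (m <= j)%N -> covariance P (fun w => \sum_(i < m) a i * Y i w)%R (Y j) <= 0.
  elim: m => [|m IH] mj.
    by under eq_fun do rewrite big_ord0; rewrite (covariance_cst_l P 0%R).
  rewrite (_ : (fun _ => _) = (fun w => \sum_(i < m) a i * Y i w)%R \+ (a m \o* Y m))%R; last first.
    by apply/funext => w; rewrite big_ord_recr/= (mulrC (Y m w)).
  rewrite covarianceDl ?Lfun2_sum ?Lfun_scale ?ler1n// covarianceZl ?Lfun2_mul_Lfun1//.
  rewrite adde_le0 ?IH ?(ltnW mj)// mule_ge0_le0 ?lee_fin ?a0//.
  by rewrite cov// neq_ltn mj.
elim: n => [|n IH].
  by under eq_fun do rewrite big_ord0; rewrite big_ord0 (variance_cst P 0%R).
rewrite (_ : (fun _ => _) = (fun w => \sum_(i < n) a i * Y i w)%R \+ (a n \o* Y n))%R; last first.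
  by apply/funext => w; rewrite big_ord_recr/= (mulrC (Y n w)).
rewrite varianceD ?Lfun2_sum ?Lfun_scale ?ler1n// varianceZ// big_ord_recr/=.
rewrite -[leRHS]adde0; apply: leeD; first exact: leeD.
rewrite covarianceZr ?Lfun2_mul_Lfun1 ?Lfun2_sum//; last exact/(Lfun_subset12 Pfin)/Lfun2_sum.
rewrite muleA mule_ge0_le0 ?covS// -EFinM lee_fin mulr_ge0//; exact: a0.
Qed.

End variance_sum.

Section square_integrability.
Context {R : realType} d (T : measurableType d) (P : probability T R).

Lemma Lfun2_max (f g : T -> R) : f \in Lfun P 2%:E -> g \in Lfun P 2%:E ->
  f \max g \in Lfun P 2%:E.
Proof.
move=> fL gL.
have mf : measurable_fun setT f by move: fL; rewrite inE => /andP[/[!inE]].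
have mg : measurable_fun setT g by move: gL; rewrite inE => /andP[/[!inE]].
have /integrableP[_ fi] := Lfun2_integrable_sqr fL.
have /integrableP[_ gi] := Lfun2_integrable_sqr gL.
apply: Lfun2P; first exact: measurable_maxr.
apply: (@le_lt_trans _ _ (\int[P]_w (`|(f w ^+ 2)%:E| + `|(g w ^+ 2)%:E|))%E).
  apply: ge0_le_integral => //.
  - by move=> w _; rewrite lee_fin sqr_ge0.
  - by apply/measurable_EFinP; apply: measurable_funX; exact: measurable_maxr.
  - apply: emeasurable_funD; apply: measurableT_comp => //;
      by apply/measurable_EFinP; exact: measurable_funX.
  move=> w _ /=; rewrite -EFinD lee_fin !ger0_norm ?sqr_ge0//.
  by have [h|h] := leP (f w) (g w); rewrite ?lerDl ?lerDr sqr_ge0.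
rewrite ge0_integralD//.
- exact: lte_add_pinfty.
- by apply: measurableT_comp => //; apply/measurable_EFinP; exact: measurable_funX.
- by apply: measurableT_comp => //; apply/measurable_EFinP; exact: measurable_funX.
Qed.

Variables (X : nat -> {RV P >-> R}).
Hypothesis XL : forall i, (X i : T -> R) \in Lfun P 2%:E.

Lemma Lfun2_pmax j : pmax (fun i => X i : T -> R) j \in Lfun P 2%:E.
Proof.
elim: j => [|j IH].
  rewrite (_ : pmax _ 0 = X 0%N)//; apply/funext => w; rewrite /pmax big_ord0//.
rewrite (_ : pmax _ j.+1 = pmax (fun i => X i : T -> R) j \max X j).
  exact: Lfun2_max.
by apply/funext => w; rewrite pmaxS.
Qed.

Lemma Lfun2_spacing j : pm_spacing (fun i => X i : T -> R) j \in Lfun P 2%:E.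
Proof.
have p1 : (1 <= 2%:E :> \bar R)%E by rewrite lee1n.
exact: (@rpredB _ (hoelder_Lfun__canonical__Algebra_ZmodClosed P p1) _ _
  (Lfun2_pmax j.+1) (Lfun2_pmax j)).
Qed.

End square_integrability.

Section law_of_F.
Context {R : realType} (F : cumulativeBounded (0:R) (1:R)).
Hypothesis F2 : (lebesgue_stieltjes_measure F).-integrable setT (fun x => (x ^+ 2)%:E).

Let idTR : measurableTypeR R -> R := idfun.

#[local] HB.instance Definition _ :=
  @isMeasurableFun.Build _ _ _ _ idTR (@measurable_id _ _ setT).

(** The identity under the Stieltjes measure of F is a random variable with cdf F, so the second
    moment hypothesis transfers to any sample with that cdf. *)
Lemma iid_Lfun2 d (T : measurableType d) (P : probability T R) (X : nat -> {RV P >-> R}) :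
  iid_cdf X F -> forall i, (X i : T -> R) \in Lfun P 2%:E.
Proof.
move=> [_ cX] i.
pose lsf : probability (measurableTypeR R) R := lebesgue_stieltjes_measure F.
pose I : {RV lsf >-> R} := idTR.
apply: (@eq_law_Lfun2 _ _ _ lsf _ _ P I (X i)).
  by move=> r; rewrite cX; exact: cdf_lebesgue_stieltjes_id.
apply: Lfun2P => //.
move/integrableP : F2 => [_]; apply: le_lt_trans.
rewrite le_eqVlt; apply/orP; left; apply/eqP; apply: eq_integral => w _ /=.
by rewrite ger0_norm ?sqr_ge0.
Qed.

End law_of_F.

Section law_of_spacing.
Context {R : realType} (F : R -> R) d1 (T1 : measurableType d1) (P1 : probability T1 R)
  d2 (T2 : measurableType d2) (P2 : probability T2 R)
  (X1 : nat -> {RV P1 >-> R}) (X2 : nat -> {RV P2 >-> R}).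
Hypotheses (iid1 : iid_cdf X1 F) (iid2 : iid_cdf X2 F).
Hypotheses (L1 : forall i, (X1 i : T1 -> R) \in Lfun P1 2%:E)
  (L2 : forall i, (X2 i : T2 -> R) \in Lfun P2 2%:E).

Lemma expectation_pmax_eq j : (0 < j)%N ->
  ('E_P1[pmax (fun i => X1 i : T1 -> R) j] = 'E_P2[pmax (fun i => X2 i : T2 -> R) j])%E.
Proof.
move=> j0.
pose Y1 : {RV P1 >-> R} := mfun_Sub (mem_set (measurable_pmax X1 j)).
pose Y2 : {RV P2 >-> R} := mfun_Sub (mem_set (measurable_pmax X2 j)).
apply: (@eq_law_expectation _ _ _ P1 _ _ P2 Y1 Y2) => [r|]; last first.
  by apply: Lfun_subset12; [exact: fin_num_measure|exact: Lfun2_pmax].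
transitivity (F r ^+ j)%:E; [rewrite -(prob_pmax_le iid1 r j0)|rewrite -(prob_pmax_le iid2 r j0)];
  by congr (_ _); apply/seteqP; split => w /=; rewrite in_itv.
Qed.

Lemma expectation_spacing_eq j : (0 < j)%N ->
  ('E_P1[pm_spacing (fun i => X1 i : T1 -> R) j] =
   'E_P2[pm_spacing (fun i => X2 i : T2 -> R) j])%E.
Proof.
move=> j0.
have E d (T : measurableType d) (P : probability T R) (X : nat -> {RV P >-> R}) :
    (forall i, (X i : T -> R) \in Lfun P 2%:E) ->
    ('E_P[pm_spacing (fun i => X i : T -> R) j] =
    'E_P[pmax (fun i => X i : T -> R) j.+1] - 'E_P[pmax (fun i => X i : T -> R) j])%E.
  move=> L; rewrite -expectationB//.
  by apply: Lfun_subset12; [exact: fin_num_measure|exact: Lfun2_pmax].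
  by apply: Lfun_subset12; [exact: fin_num_measure|exact: Lfun2_pmax].
by rewrite !E// !expectation_pmax_eq.
Qed.

End law_of_spacing.

Section spacing_ratio.
Context {R : realType} d (T : measurableType d) (P : probability T R)
  (X : nat -> {RV P >-> R}) (F : R -> R).
Local Notation Z := (pm_spacing (fun i => X i : T -> R)).
Hypothesis iidX : iid_cdf X F.
Hypothesis XL : forall i, (X i : T -> R) \in Lfun P 2%:E.

(** With 2^K <= i < 2^(K+1), the second moment bound d_K^2 / 2^K is a constant times 2^K (u d_K / (8
    * 2^K))^2. The square is at most that of E[Z_i], and 2^K <= i. *)
Lemma spacing_ratio (x : nat -> R) (u C rho B : R) :
  dyadic_levels F x u C rho B -> 0 < C -> 1 < rho -> rho ^+ 2 < 2 -> 2 <= B ->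
  exists2 G, 0 <= G & forall i, (0 < i)%N -> 0 < fine 'E_P[Z i] /\
    ('V_P[Z i] <= (G * i%:R * fine 'E_P[Z i] ^+ 2)%:E)%E.
Proof.
move=> lev C0 r1 r2 B2; have [/andP[u0 uh] Fx xinc _ _] := lev.
have Pfin : P setT \is a fin_num := fin_num_measure P _ measurableT.
pose h w := Num.max 0 (x 0 - X 0%N w).
have hL : h \in Lfun P 2%:E.
  apply: (@Lfun2_max _ _ _ P (cst 0) (fun w => x 0 - X 0%N w)); first exact: Lfun_cst.
  have p1 : (1 <= 2%:E :> \bar R)%E by rewrite lee1n.
  exact: (@rpredB _ (hoelder_Lfun__canonical__Algebra_ZmodClosed P p1) _ _
    (Lfun_cst _ (x 0) _) (XL 0%N)).
have hfin : (\int[P]_w (h w ^+ 2)%:E)%E \is a fin_num.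
  by apply: integrable_fin_num => //; exact: Lfun2_integrable_sqr.
pose J := fine (\int[P]_w (h w ^+ 2)%:E)%E.
have J0 : 0 <= J by apply: fine_ge0; apply: integral_ge0 => w _; rewrite lee_fin sqr_ge0.
have [G G0 hG] := dyadic_sum_upper lev C0 r1 r2 B2 J0.
exists (G * (8 / u) ^+ 2); first by rewrite mul_sqr_ge0.
move=> i i0; pose K := trunc_log 2 i.
have Ki : (2 ^ K <= i)%N by exact: trunc_logP.
have iK : (i < 2 ^ K.+1)%N by exact: trunc_log_ltn.
have ZL := Lfun2_spacing XL i; have Z1 := Lfun_subset12 Pfin ZL.
have Efin : 'E_P[Z i]%E \is a fin_num by exact: expectation_fin_num.
set e := fine _; set dK := x K.+1 - x K.
have dK0 : 0 < dK by rewrite subr_gt0.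
have elow : u / 8 * dK / 2 ^+ K <= e.
  apply: le_trans (dyadic_gap_lower iK lev) _; rewrite -lee_fin fineK//.
  exact/(expectation_spacing_ge iidX i0)/ltW.
have p2 : (0 : R) < 2 ^+ K by rewrite exprn_gt0.
have e0 : 0 < u / 8 * dK / 2 ^+ K by rewrite divr_gt0// mulr_gt0// divr_gt0.
split; first exact: lt_le_trans elow.
rewrite varianceE//; apply: (@le_trans _ _ 'E_P[Z i ^+ 2]%E).
  by rewrite -[leRHS]sube0 leeB// sqre_ge0.
have := integral_sqr_spacing_le iidX K i0 lev C0 r1 r2.
rewrite -/(h _) -[X in (4%:E * (_ * X))%E]fineK// -/J -!EFinM -EFinD.
move=> h1; rewrite unlock; apply: (le_trans h1).
rewrite lee_fin; apply: le_trans (hG i K i0 Ki) _; rewrite -/dK.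
have Kir : (2 ^+ K : R) <= i%:R by rewrite -natrX ler_nat.
have h2 : (u / 8 * dK / 2 ^+ K) ^+ 2 <= e ^+ 2.
  by rewrite ler_sqr ?nnegrE ?(ltW e0)// (le_trans (ltW e0)).
have -> : G * (dK ^+ 2 / 2 ^+ K) = G * (8 / u) ^+ 2 * (2 ^+ K * (u / 8 * dK / 2 ^+ K) ^+ 2).
  by move: (2 ^+ K) p2 => p p2; field; rewrite !gt_eqF.
rewrite -[leRHS]mulrA ler_wpM2l ?mul_sqr_ge0//.
by apply: ler_pM; rewrite ?sqr_ge0 ?(ltW p2).
Qed.

End spacing_ratio.

Lemma ln_le_harmonic {R : realType} m : ln m.+1%:R <= \sum_(i < m) (i.+1%:R : R)^-1.
Proof.
elim: m => [|m IH]; first by rewrite ln1 big_ord0.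
rewrite big_ord_recr/=; have m0 : (0 : R) < m.+1%:R by rewrite ltr0n.
have -> : m.+2%:R = m.+1%:R * (1 + m.+1%:R^-1) :> R.
  by rewrite mulrDr mulr1 divff ?gt_eqF// natr1.
rewrite lnM ?posrE ?addr_gt0 ?invr_gt0// lerD// le_ln1Dx//.
by rewrite (@lt_trans _ _ 0)// invr_gt0.
Qed.

Lemma expectation_lincomb {R : realType} d (T : measurableType d) (P : probability T R)
    m (a : nat -> R) (Y : nat -> T -> R) : (forall i, Y i \in Lfun P 2%:E) ->
  ('E_P[(fun w => \sum_(i < m) a i * Y i w)%R] =
   (\sum_(i < m) a i * fine 'E_P[Y i]%E)%R%:E)%E.
Proof.
move=> YL; have Pfin : P setT \is a fin_num := fin_num_measure P _ measurableT.
elim: m => [|m IH].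
  by under eq_fun do rewrite big_ord0; rewrite big_ord0 expectation_cst.
rewrite (_ : (fun _ => _) = (fun w => \sum_(i < m) a i * Y i w) \+ (a m \o* Y m)).
  rewrite expectationD ?(Lfun_subset12 Pfin) ?Lfun2_sum ?Lfun_scale ?ler1n//.
  rewrite IH expectationZl ?(Lfun_subset12 Pfin)// big_ord_recr EFinD EFinM fineK//.
  exact/expectation_fin_num/Lfun_subset12.
by apply/funext => w; rewrite big_ord_recr/= (mulrC (Y m w)).
Qed.

(** * The competitor of the BLUE *)

Section competitor.
Context {R : realType} (F : cumulativeBounded (0:R) (1:R)).
Hypothesis F2 : (lebesgue_stieltjes_measure F).-integrable setT (fun x => (x ^+ 2)%:E).
Context d (T : measurableType d) (P : probability T R) (Y : nat -> {RV P >-> R}).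
Hypothesis iidY : iid_cdf Y F.
Local Notation e i := (fine 'E_P[pm_spacing (fun i => Y i : T -> R) i]).

(** These weights minimise the sum of a_i^2 i E[Z_i]^2 when the sum of a_i E[Z_i] is 1; the minimum
    is 1 over the harmonic sum. The value 0 at index 0 is what the Abel summation requires. *)
Definition harmonic_weight m (i : nat) : R :=
  if i is i'.+1 then (i%:R * e i * \sum_(j < m) (j.+1%:R)^-1)^-1 else 0.

Lemma pm_est_affine (t1 t2 : R) d' (T' : measurableType d') (P' : probability T' R)
    (X : nat -> {RV P' >-> R}) (t20 : 0 < t2) m w :
  pm_est m.+1 (spacing_coef m.+1 (harmonic_weight m)) (fun i => X i : T' -> R) w =
  \sum_(i < m) (t2 * harmonic_weight m i.+1) *
    pm_spacing (fun i => standardized X t1 t2 i : T' -> R) i.+1 w.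
Proof.
rewrite pm_est_spacing// big_ord_recl /= mul0r add0r; apply: eq_bigr => i _.
rewrite (@pm_spacing_affine _ _ t1 t2 (fun i => X i : T' -> R)
  (fun i => standardized X t1 t2 i : T' -> R) i.+1 w t20
  (fun i => standardizedK X t1 t20 i w)).
by rewrite mulrCA mulrA.
Qed.

Lemma harmonic_sum_gt0 m : (0 < m)%N -> 0 < \sum_(j < m) (j.+1%:R : R)^-1.
Proof.
by case: m => // m _; rewrite big_ord_recl ltr_pwDl ?invr_gt0 ?ltr0n//; apply: sumr_ge0.
Qed.

Lemma unbiased_competitor m : (0 < m)%N -> (forall i, (0 < i)%N -> 0 < e i) ->
  pm_unbiased_scale F m.+1 (spacing_coef m.+1 (harmonic_weight m)).
Proof.
move=> m0 e0 t1 t2 t20 d' T' P' X iidX.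
have iidS := iid_standardized t20 iidX.
have SL := iid_Lfun2 F2 iidS; have YL := iid_Lfun2 F2 iidY.
rewrite (_ : pm_est _ _ _ = (fun w => \sum_(i < m) (t2 * harmonic_weight m i.+1) *
    pm_spacing (fun i => standardized X t1 t2 i : T' -> R) i.+1 w)); last first.
  by apply/funext => w; exact: pm_est_affine.
rewrite (expectation_lincomb m (fun i => t2 * harmonic_weight m i.+1)
  (Y := fun i => pm_spacing (fun i => standardized X t1 t2 i : T' -> R) i.+1)); last first.
  by move=> i; exact: Lfun2_spacing.
congr (_%:E); have H0 := harmonic_sum_gt0 m0.
(* The expectation on the arbitrary space is replaced by the one that defines the weights and
   cancels, leaving t2 / H times 1 / (i + 1), with H the harmonic sum. *)
under eq_bigr => i _.
  rewrite (expectation_spacing_eq iidS iidY SL YL)//= !invfM.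
  rewrite (_ : _ * _ = (t2 / \sum_(j < m) (j.+1%:R)^-1) * (i.+1%:R)^-1); last first.
    have := e0 i.+1 isT; set ei := fine _ => ei0.
    by move: (\sum_(j < m) _) H0 => H H0; field; rewrite nat1r !gt_eqF// ltr0n.
  over.
by rewrite -mulr_sumr divfK ?gt_eqF.
Qed.

(** Each variance contributes t2^2 G / (H^2 i), with H the harmonic sum, so the total is t2^2 G / H,
    and H >= ln (m + 1). *)
Lemma variance_competitor (G t1 t2 : R) (X : nat -> {RV P >-> R}) m :
  (0 < m)%N -> 0 < t2 -> iid_cdf X (locscale F t1 t2) -> Y = standardized X t1 t2 ->
  NCP F -> 0 <= G ->
  (forall i, (0 < i)%N -> 0 < e i /\
    ('V_P[pm_spacing (fun i => Y i : T -> R) i] <= (G * i%:R * e i ^+ 2)%:E)%E) ->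
  ('V_P[pm_est m.+1 (spacing_coef m.+1 (harmonic_weight m)) (fun i => X i : T -> R)] <=
   (t2 ^+ 2 * G / ln m.+1%:R)%:E)%E.
Proof.
move=> m0 t20 iidX YE ncp G0 eV; have H0 := harmonic_sum_gt0 m0.
have YL := iid_Lfun2 F2 iidY.
have a0 i : 0 <= harmonic_weight m i.+1.
  by rewrite invr_ge0 !mulr_ge0 ?(ltW H0) ?(ltW (eV i.+1 isT).1).
rewrite (_ : pm_est _ _ _ = (fun w => \sum_(i < m) (t2 * harmonic_weight m i.+1) *
    pm_spacing (fun i => Y i : T -> R) i.+1 w)); last first.
  by apply/funext => w; rewrite YE; exact: pm_est_affine.
have := @variance_sum_le _ _ _ P m (fun i => t2 * harmonic_weight m i.+1)
  (fun i => pm_spacing (fun i => Y i : T -> R) i.+1).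
move=> /(_ _ _ _)/le_trans; apply.
- by move=> i; exact: Lfun2_spacing.
- by move=> i; rewrite mulr_ge0// ltW.
(* The spacings are indexed from [i.+1], so both indices are positive as [NCP] demands. *)
- by move=> i j ij; apply: ncp.
apply: (@le_trans _ _ (\sum_(i < m)
    ((t2 ^+ 2 * G / (\sum_(j < m) (j.+1%:R)^-1) ^+ 2) * (i.+1%:R)^-1)%:E)%E).
  apply: lee_sum => i _; have [ei0 Vi] := eV i.+1 isT.
  apply: le_trans (lee_wpmul2l _ Vi) _; first by rewrite lee_fin sqr_ge0.
  rewrite -EFinM lee_fin /=; move: ei0; set ei := fine _ => ei0.
  rewrite le_eqVlt; apply/orP; left; apply/eqP.
  by move: (\sum_(j < m) _) H0 => H H0; field; rewrite nat1r !gt_eqF// ltr0n.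
rewrite sumEFin lee_fin -mulr_sumr.
have lm : 0 < ln (m.+1%:R : R) by rewrite ln_gt0// ltr1n ltnS.
have := ln_le_harmonic (R := R) m; move: (\sum_(j < m) _) H0 => H H0 lH.
have -> : t2 ^+ 2 * G / H ^+ 2 * H = t2 ^+ 2 * G / H by field; rewrite gt_eqF.
by apply: ler_wpM2l; [rewrite mulr_ge0 ?sqr_ge0|rewrite lef_pV2 ?posrE].
Qed.

End competitor.

(** * Rate and consistency *)

Lemma cvg_div_ln {R : realType} (K : R) : (K / ln n%:R)%:E @[n --> \oo] --> 0%E.
Proof.
apply: cvg_EFin; first by near=> n.
rewrite -[X in _ --> X](mulr0 K); apply: cvgMr.
have h : ln n%:R @[n --> \oo] --> (+oo%R : set_system R).
  apply/cvgryPge => A; near=> n.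
  rewrite -(expRK A) ler_ln ?posrE ?expR_gt0//; last by rewrite ltr0n; near: n; exists 1%N.
  by near: n; exact: nbhs_infty_ger.
apply/gtr0_cvgV0 => //; near=> n.
by rewrite ln_gt0// ltr1n; near: n; exists 2%N.
Unshelve. all: end_near.
Qed.

Lemma measurable_pm_est {R : realType} d (T : measurableType d) (P : probability T R)
    (X : nat -> {RV P >-> R}) n c :
  measurable_fun setT (pm_est n c (fun i => X i : T -> R)).
Proof.
apply: measurable_sum => i; apply: measurable_funM => //; exact: measurable_pmax.
Qed.

Theorem theorem5p2 (R : realType) (F : cumulativeBounded (0:R) (1:R))
    (f : R -> R) (M : R) (c : nat -> nat -> R) :
  (* F is non-degenerate *)
  (exists x, 0 < F x < 1) ->
  (* F has finite second moment *)
  (lebesgue_stieltjes_measure F).-integrable setT (fun x => (x ^+ 2)%:E) ->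
  (* F belongs to NCP *)
  NCP F ->
  (* lim_{x -> omega-} F(x) = 1 *)
  (F : R -> R) @ at_left_e (right_endpoint F) --> (1 : R) ->
  (* F is differentiable on (M, omega) with derivative f *)
  (M%:E < right_endpoint F)%E ->
  (forall x, M < x -> (x%:E < right_endpoint F)%E -> is_derive x 1 (F : R -> R) (f x)) ->
  (* condition (i) or (ii) *)
  ((exists gamma : R, gamma < 3 / 2 /\
      [/\ (0 < Llow f F 0 gamma)%E, (Llow f F 0 gamma <= Lupp f F 0 gamma)%E
        & (Lupp f F 0 gamma < +oo)%E]) \/
   (exists delta gamma : R, 0 < delta /\ 1 / 2 < gamma <= 1 /\
      [/\ (0 < Llow f F delta gamma)%E, (Llow f F delta gamma <= Lupp f F delta gamma)%E
        & (Lupp f F delta gamma < +oo)%E])) ->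
  (* c n is the coefficient vector of the partial maxima BLUE L_2^(n) of theta_2 *)
  (forall n : nat, (2 <= n)%N -> pm_BLUE_scale F n (c n)) ->
  forall t1 t2 : R, 0 < t2 ->
  forall d (T : measurableType d) (P : probability T R) (X : nat -> {RV P >-> R}),
    iid_cdf X (locscale F t1 t2) ->
    (* consistency: L_2^(n) -> theta_2 in probability *)
    (forall eps : R, 0 < eps ->
       P [set w | eps <= `| pm_est n (c n) (fun i => X i : T -> R) w - t2 |]
         @[n --> \oo] --> 0%E) /\
    (* Var[L_2^(n)] = O(1 / log n) *)
    (exists K : R, \forall n \near \oo,
       ('V_P[pm_est n (c n) (fun i => X i : T -> R)] <= (K / ln n%:R)%:E)%E).
Proof.
move=> _ F2 ncp Fw Mw dF cond blue t1 t2 t20 d T P X iidX.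
have iidY := iid_standardized t20 iidX.
have YL := iid_Lfun2 F2 iidY.
have F1 s : F s <= 1 by case/andP: (iid_cdf_itv iidY s).
have Fnd : {homo (F : R -> R) : s t / s <= t} by exact: cumulative_is_nondecreasing.
have [x [u [C [rho [B [lev C0 r1 r2 B2]]]]]] : exists x u C rho B,
    [/\ dyadic_levels F x u C rho B, 0 < C, 1 < rho, rho ^+ 2 < 2 & 2 <= B].
  case: cond => [[g [g32 [L1 _ L2]]]|[e [g [e0 [/andP[_ g1] [L1 _ L2]]]]]].
    exact: dyadic_levels_of_tail Fnd F1 Fw Mw dF (lexx 0) g32 L1 L2.
  by apply: dyadic_levels_of_tail Fnd F1 Fw Mw dF (ltW e0) _ L1 L2; lra.
have [G G0 hG] := spacing_ratio iidY YL lev C0 r1 r2 B2.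
have var n : (2 <= n)%N ->
    ('V_P[pm_est n (c n) (fun i => X i : T -> R)] <= (t2 ^+ 2 * G / ln n%:R)%:E)%E.
  (* The n = m + 1 maxima carry the spacings Z_1, ..., Z_m; n >= 2 provides at least one of them and
     makes ln n positive. *)
  case: n => [|m] // m1; have [_ opt] := blue _ m1.
  have comp := variance_competitor F2 iidY m1 t20 iidX erefl ncp G0 hG.
  apply: le_trans comp; apply: (opt _ _ t1 t2) => //.
  by apply: unbiased_competitor => // i i0; case: (hG i i0).
split; last by exists (t2 ^+ 2 * G); near=> n; apply: var; near: n; exists 2%N.
move=> eps eps0.
apply: (@squeeze_cvge _ _ _ _ (fun=> 0%E) _
  (fun n => (eps ^- 2 * (t2 ^+ 2 * G) / ln n%:R)%:E)); last exact: cvg_div_ln; last first.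
  exact: cvg_cst.
near=> n; have n2 : (2 <= n)%N by near: n; exists 2%N.
rewrite measure_ge0/=.
pose L : {RV P >-> R} := mfun_Sub (mem_set (measurable_pm_est X n (c n))).
(* Chebyshev's inequality is centred at the mean, which unbiasedness identifies with t2. *)
have := chebyshev L eps0.
have -> : ('E_P[L] = t2%:E)%E by have [unb _] := blue _ n2; exact: (unb _ _ t20 _ _ _ _ iidX).
move=> /le_trans; apply.
rewrite -mulrA EFinM lee_wpmul2l// ?lee_fin ?invr_ge0 ?exprn_ge0 ?(ltW eps0)//.
exact: var.
Unshelve. all: end_near.
Qed.
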